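(* Let $G$ be a finitely generated group. Then $G$ is hyperbolic if and only if $G$ is $\mathbb{Q}\mathbf{REG}$, i.e. if and only if for every rational number $\lambda \geq 1$, every real number $\epsilon \geq 0$ and every finite generating set $S$ of $G$, the set of $(\lambda,\epsilon)$-quasigeodesic words over $S\cup S^{-1}$ is a regular language.
   Context: For a group $G$ with finite generating set $S$, $\Gamma(G,S)$ denotes the Cayley graph: vertices are the elements of $G$ and edges are $\{g,gs\}$ with $g\in G$, $s\in S$. $d_G$ denotes the associated word metric on $G$ (the restriction of the graph metric to vertices). A metric space is $\delta$-hyperbolic (for $\delta\ge 1$) if every geodesic triangle in it is $\delta$-thin, i.e. each side is contained in the $\delta$-neighbourhood of the union of the other two sides; a metric space is hyperbolic if it is $\delta$-hyperbolic for some $\delta$. A finitely generated group $G$ is hyperbolic if $\Gamma(G,S)$ (with its path metric, each edge having length 1) is $\delta$-hyperbolic for some $\delta$ and some finite generating set $S$. Each word over the alphabet $S\cup S^{-1}$ labels a simplicial path in $\Gamma(G,S)$ starting at the identity $e$. For $\lambda\ge1$, $\epsilon\ge0$, a finite word $w$ over $S\cup S^{-1}$ is a $(\lambda,\epsilon)$-quasigeodesic word if every (contiguous) subword $u$ of $w$ satisfies $\mathrm{length}(u)\le \lambda\, d_G(e,u)+\epsilon$, where in $d_G(e,u)$ the word $u$ is identified with the element of $G$ it represents. Equivalently, the simplicial path $c:[0,a]\to\Gamma(G,S)$ labelled by $w$ satisfies $|x-y|\le\lambda d_G(c(x),c(y))+\epsilon$ for all integers $x,y\in[0,a]$. A language over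 a finite alphabet $A$ is a subset of the free monoid $A^\star$; it is regular if it is the set of words accepted by some finite state automaton over $A$ (a finite directed graph with edges labelled by elements of $A$, one initial vertex and a set of final vertices; a word is accepted if it labels a directed path from the initial vertex to a final vertex). *)

(* Defs.v *)
From HB Require Import structures.
From mathcomp Require Import all_boot all_order all_algebra finmap.
From mathcomp Require Import all_classical all_reals.

Set Implicit Arguments.
Unset Strict Implicit.
Unset Printing Implicit Defensive.

Import Order.TTheory GRing.Theory Num.Theory.
Local Open Scope classical_set_scope.
Local Open Scope ring_scope.

Section HyperbolicSpaces.
Variables (R : realType) (T : Type) (d : T -> T -> R).

Definition geodesic_segment (x y : T) (A : set T) : Prop :=
  exists (l : R) (c : R -> T),
    [/\ 0 <= l, c 0 = x, c l = y,
        (forall s t, 0 <= s <= l -> 0 <= t <= l -> d (c s) (c t) = `|s - t|)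
      & A = [set c t | t in [set t | 0 <= t <= l]]].

Definition nbhd (delta : R) (A : set T) : set T :=
  [set p | exists2 q, A q & d p q <= delta].

Definition delta_hyperbolic (delta : R) : Prop :=
  forall (x y z : T) (A B C : set T),
    geodesic_segment x y A -> geodesic_segment y z B ->
    geodesic_segment z x C ->
    [/\ A `<=` nbhd delta (B `|` C),
        B `<=` nbhd delta (C `|` A)
      & C `<=` nbhd delta (A `|` B)].

Definition hyperbolic_space : Prop :=
  exists2 delta : R, 1 <= delta & delta_hyperbolic delta.

End HyperbolicSpaces.

Section Automata.
Variable A : finType.

Record automaton := Automaton {
  state : finType;
  initial : state;
  final : {set state};
  edge : state -> A -> state -> bool
}.

Fixpoint accepts_from (M : automaton) (q : state M) (w : seq A) : Prop :=
  match w with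
  | [::] => q \in final M
  | a :: w' => exists2 q', edge q a q' & accepts_from q' w'
  end.

Definition regular (L : set (seq A)) : Prop :=
  exists M : automaton, L = [set w | accepts_from (initial M) w].

End Automata.

Section CayleyGraphs.
Variables (R : realType) (G : groupType).
Implicit Types (S : {fset G}) (g h : G).

Definition alphabet S : {fset G} := (S `|` [fset (s^-1)%g | s in S])%fset.

Definition eval S (w : seq (alphabet S)) : G := (\big[*%g/1]_(a <- w) val a)%g.

Definition generating S : Prop := forall g, exists w : seq (alphabet S), eval w = g.

(* Points of the geometric realization of the Cayley graph are given by their
   barycentric coordinates G -> R, so that {g, gs} and {gs, gs s^-1} give the
   same edge, and the degenerate edge {g, g1} is just the vertex g. *)
Definition vertex g : G -> R := fun x => (x == g)%:R.

Definition edge_point g h (t : R) : G -> R :=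
  fun x => (1 - t) * vertex g x + t * vertex h x.

Definition in_cayley_graph S (p : G -> R) : Prop :=
  (exists g, p = vertex g) \/
  (exists g s t, [/\ s \in S, 0 <= t <= 1 & p = edge_point g (g * s)%g t]).

(* Finite concatenations of segments, each within one edge of length 1;
   the last index is the total length. *)
Inductive cayley_path S : (G -> R) -> (G -> R) -> R -> Prop :=
| CayleyNil p : cayley_path S p p 0
| CayleyCons g s t t' q l :
    s \in S -> 0 <= t <= 1 -> 0 <= t' <= 1 ->
    cayley_path S (edge_point g (g * s)%g t') q l ->
    cayley_path S (edge_point g (g * s)%g t) q (`|t - t'| + l).

(* [inf] is only meaningful here when any two points are joined by a path,
   i.e. when S generates G. *)
Definition path_metric S (p q : G -> R) : R := inf [set l | cayley_path S p q l].

Definition cayley_graph S : Type := {p : G -> R | in_cayley_graph S p}.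

Definition cayley_dist S (p q : cayley_graph S) : R :=
  path_metric S (sval p) (sval q).

Definition word_dist S g h : R := path_metric S (vertex g) (vertex h).

Definition quasigeodesic S (lambda eps : R) (w : seq (alphabet S)) : Prop :=
  forall u, infix u w -> (size u)%:R <= lambda * word_dist S 1%g (eval u) + eps.

End CayleyGraphs.

Definition finitely_generated (G : groupType) : Prop :=
  exists S : {fset G}, generating S.

Definition hyperbolic_group (R : realType) (G : groupType) : Prop :=
  exists2 S : {fset G}, generating S & hyperbolic_space (@cayley_dist R G S).

Definition QREG (R : realType) (G : groupType) : Prop :=
  forall (lambda : rat) (eps : R) (S : {fset G}),
    1 <= lambda -> 0 <= eps -> generating S ->
    regular [set w : seq (alphabet S) | quasigeodesic (ratr lambda) eps w].

(* Main.v *)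
Require Import Defs.
From HB Require Import structures.
From mathcomp Require Import all_boot all_order all_algebra finmap.
From mathcomp Require Import all_classical all_reals.
From mathcomp Require Import zify ring lra.

(** Both directions go through Gromov's four-point condition for the integer
    valued word metric.  It speaks of distances only, so it can be moved between
    the vertices and the points of the Cayley graph
    ([four_point_cayley_hyperbolic], [cayley_hyperbolic_thin]).

    From hyperbolicity to regularity.  By stability of quasigeodesics, proved
    for sequences that are quasigeodesic with respect to another generating set
    ([quasi_geodesics_fellow_travel]), a quasigeodesic path [b] and a geodesic
    [g] with the same ends travel together: there is a monotone [t] such that
    [g (t i)] stays at distance at most [R] of [b i].  Write [lambda = p / q] and
    let [E] be the integer part of [q eps]; a word [u] is bad if
    [q |u| > p d(1,u) + E].  Along a shortest bad word the
    integers [q i - p (t i)] are bounded, because all its proper infixes are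
    good.  So a finite automaton can guess the start of the bad infix, remember
    the element [b_i^-1 (g (t i))] of a ball and that integer, and check the
    inequality at the end ([bad_automaton]).  This is where rationality of
    [lambda] matters.  The quasigeodesic words are the complement
    ([four_point_regular]).

    From regularity to hyperbolicity only the constants [(1,0)] and [(3,0)] are
    used.  Suppose that a word [w] is not a (3,0)-quasigeodesic although its
    proper infixes are, and that [w = x g z] with [g] a long geodesic.  Pumping
    some piece [y] of [g] in automata for both languages keeps [y^k] geodesic
    and keeps [x' y^k z'] bad.  But then [x' y^k z'] is about [k |y|] long and
    joins points about [k |y|] apart, which contradicts badness for large [k].
    So minimal bad words contain no long geodesic
    ([minimal_bad_geodesic_infix]), and a concatenation of at most five
    geodesics is a (3,0)-quasigeodesic as soon as its infixes of length at most
    some [K] are ([piecewise_local_to_global]).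

    The paths to which this applies come from shortest bridges.  If [b] is a
    shortest path between two geodesics [a] and [c], then [a b] and [b c] are
    (3,0)-quasigeodesics, so [a b c] is one at the scale [|b|]; when
    [|b| >= K] it is one globally ([quasi_word_bridge]).  Hence two sides of a
    triangle that part from each other beyond distance [K] come back only within
    bounded time ([excursion_length]).  If a side stays away from both other
    sides for long, then that stretch, two bridges and the remaining parts of
    the other two sides form a closed pentagon that is a (3,0)-quasigeodesic,
    which is absurd ([pentagon]).  So triangles are thin. *)

Set Implicit Arguments.
Unset Strict Implicit.
Unset Printing Implicit Defensive.
Import Order.TTheory GRing.Theory Num.Theory.

Local Open Scope nat_scope.

Lemma last_true_upto (P : nat -> Prop) a n : a <= n -> P a ->
  exists m, [/\ a <= m, m <= n, P m & forall k, m < k <= n -> ~ P k].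
Proof.
move=> an Pa; have exP : exists i, `[< P i /\ i <= n >] by exists a; apply/asboolP.
have ub i : `[< P i /\ i <= n >] -> i <= n by move/asboolP => [].
case: (ex_maxnP exP ub) => m /asboolP [Pm mn] maxm.
exists m; split=> //; first by apply: maxm; apply/asboolP.
move=> k /andP[mk kn] Pk.
by have := maxm k (introT (asboolP _) (conj Pk kn)); lia.
Qed.

Lemma first_true_from (P : nat -> Prop) n b : n <= b -> P b ->
  exists m, [/\ n <= m, m <= b, P m & forall k, n <= k < m -> ~ P k].
Proof.
move=> nb Pb; have exP : exists i, `[< P i /\ n <= i >] by exists b; apply/asboolP.
case: (ex_minnP exP) => m /asboolP [Pm mn] minm.
exists m; split=> //; first by apply: minm; apply/asboolP.
move=> k /andP[nk km] Pk.
by have := minm k (introT (asboolP _) (conj Pk nk)); lia.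
Qed.

(** * Discrete geodesic metrics and the four-point condition *)

Section DiscreteMetric.
Variables (T : Type) (d : T -> T -> nat).

Record geodesic_metric : Prop := GeodesicMetric {
  dist_refl : forall x, d x x = 0;
  dist_eq0 : forall x y, d x y = 0 -> x = y;
  dist_sym : forall x y, d x y = d y x;
  dist_triangle : forall x y z, d x z <= d x y + d y z;
  dist_divide : forall x y m, m <= d x y ->
    exists2 u, d x u = m & d u y = d x y - m }.

Definition between x u y := d x u + d u y = d x y.

Definition geodesic_seq n (g : nat -> T) :=
  forall i j, i <= j <= n -> d (g i) (g j) = j - i.

(** The interval of [x] and [y] is the union of all geodesics between them.
    Measuring the distance to intervals rather than to chosen geodesics makes
    this weaker than thinness of triangles, and still enough for the four-point
    condition. *)
Definition thin_intervals delta :=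
  forall x y z u, between x u y ->
    exists2 v, between x v z \/ between y v z & d u v <= delta.

Definition four_point delta :=
  forall x y z w,
    d x z + d y w <= maxn (d x y + d z w) (d x w + d y z) + delta.

Hypothesis dP : geodesic_metric.
Let d0 := dist_refl dP.
Let dC := dist_sym dP.
Let dD := dist_triangle dP.

Lemma geodesic_seq_ex x y :
  exists g, [/\ g 0 = x, g (d x y) = y & geodesic_seq (d x y) g].
Proof.
have [n dxy] : exists n, d x y = n by exists (d x y).
elim: n y dxy => [|n IHn] y dxy.
  exists (fun=> x); rewrite dxy; split=> //; first exact: dist_eq0 dP _ _ dxy.
  by move=> i j ij; rewrite d0; lia.
have [|u xu uy] := dist_divide dP (x := x) (y := y) (m := n); first by lia.
have [g [g0 gn gP]] := IHn u xu; rewrite dxy xu in uy gn gP *.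
exists (fun i => if i <= n then g i else y); rewrite ltnn; split=> // i j ij.
case: (leqP j n) => [jn|nj]; first by rewrite ifT ?gP; lia.
case: (leqP i n) => [ni|iN]; last by rewrite d0; lia.
have := dD (g i) u y; have := dD x (g i) y.
have := gP 0 i ni; have := gP i n; rewrite g0 gn leqnn andbT => /(_ ni).
lia.
Qed.

Lemma geodesic_seq_between n g i : geodesic_seq n g -> i <= n ->
  between (g 0) (g i) (g n).
Proof. by move=> gP ni; rewrite /between !gP; lia. Qed.

(** On a geodesic from [x] to [y], let [p] be the last point near the interval of
    [x] and [w].  The next point is near that of [y] and [w], so [p] is near both,
    and [d w p] is the Gromov product of [x] and [y] at [w] up to a constant. *)
Lemma thin_intervals_projection delta : thin_intervals delta ->
  forall w x y, exists2 p, between x p y &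
    2 * d w p + d x y <= d w x + d w y + 4 * delta + 2.
Proof.
move=> thin w x y; have [g [g0 gn gP]] := geodesic_seq_ex x y.
pose P i := exists2 v, between x v w & d (g i) v <= delta.
have P0 : P 0 by exists x; rewrite /between ?g0 d0.
have [i [_ le_i [v xvw iv] maxi]] := last_true_upto (leq0n (d x y)) P0.
have [v' yv'w iv'] : exists2 v', between y v' w & d (g i) v' <= delta.+1.
  case: (ltngtP i (d x y)) le_i => // [lti _|-> _].
    have iB : between x (g i.+1) y.
      by have := geodesic_seq_between gP lti; rewrite g0 gn.
    have [v' [xv'w|yv'w] iv'] := thin x y w _ iB.
      by case: (maxi i.+1); rewrite ?ltnSn //; exists v'.
    exists v' => //; have := dD (g i) (g i.+1) v'; have := gP i i.+1; lia.
  by exists y; rewrite ?gn /between d0.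
exists (g i); first by have := geodesic_seq_between gP le_i; rewrite g0 gn.
have := gP 0 i le_i; have := gP i (d x y); rewrite g0 gn leqnn andbT => /(_ le_i).
move: xvw yv'w; rewrite /between.
have := dD x v (g i); have := dD (g i) v w; have := dD y v' (g i).
have := dD (g i) v' w.
rewrite (dC v (g i)) (dC v' (g i)) (dC w x) (dC w y) (dC w (g i)) (dC (g i) y); lia.
Qed.

(** The projection [p] of [w] to a geodesic from [x] to [z] lies near the
    interval of [y] with [x] or with [z], and a Gromov product at [w] never
    exceeds the distance to the interval. *)
Lemma thin_intervals_four_point delta :
  thin_intervals delta -> four_point (6 * delta + 2).
Proof.
move=> thin x y z w.
have [p xpz pP] := thin_intervals_projection thin w x z.
have [v xzvy pv] := thin x z y p xpz.
have := dD w p v; have := dD w v x; have := dD w v y; have := dD w v z.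
move: pP; rewrite (dC v x) (dC v z).
by case: xzvy; rewrite /between (dC w x) (dC w y) (dC w z) ?(dC y z) => ?; lia.
Qed.

(** Cutting the chain in two halves costs [delta] once, so the loss is only
    logarithmic in its length.  The number [M] is a lower bound for twice the
    Gromov products at [x] of consecutive points. *)
Lemma four_point_chain delta : four_point delta ->
  forall k x m M (c : nat -> T), 0 < m <= 2 ^ k ->
  (forall i, i < m -> M + d (c i) (c i.+1) <= d x (c i) + d x (c i.+1)) ->
  M + d (c 0) (c m) <= d x (c 0) + d x (c m) + delta * k.
Proof.
move=> fp; elim=> [|k IHk] x m M c /andP[m0 mk] cP.
  rewrite expn0 in mk; have -> : m = 1 by [lia].
  by rewrite muln0 addn0; exact: cP 0 m0.
have [le_m|lt_m] := leqP m (2 ^ k).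
  have : M + d (c 0) (c m) <= d x (c 0) + d x (c m) + delta * k.
    by apply: IHk => //; rewrite m0.
  by rewrite mulnS; lia.
have le1 : 0 < 2 ^ k by rewrite expn_gt0.
have IH1 := IHk x (2 ^ k) M c.
have IH2 := IHk x (m - 2 ^ k) M (fun i => c (2 ^ k + i)).
rewrite /= addn0 subnKC in IH2; last by lia.
have {}IH1 : M + d (c 0) (c (2 ^ k)) <= d x (c 0) + d x (c (2 ^ k)) + delta * k.
  by apply: IH1; [lia|move=> i im; apply: cP; lia].
have {}IH2 : M + d (c (2 ^ k)) (c m) <= d x (c (2 ^ k)) + d x (c m) + delta * k.
  apply: IH2; first by move: mk; rewrite expnS; lia.
  by move=> i im; rewrite addnS; apply: cP; lia.
have := fp (c 0) x (c m) (c (2 ^ k)).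
rewrite mulnS (dC (c 0) x) (dC (c m) (c _)) ; lia.
Qed.

(** * Stability of quasi-geodesics *)

(** Steps of length [C] are allowed so that a path for one generating set is such
    a sequence for the word metric of another one. *)
Definition quasi_geodesic_seq C L E n (b : nat -> T) :=
  (forall i, i < n -> d (b i) (b i.+1) <= C) /\
  (forall i j, i <= j <= n -> j - i <= L * d (b i) (b j) + E).

Lemma quasi_geodesic_seq_lipschitz C L E n b : quasi_geodesic_seq C L E n b ->
  forall i j, i <= j <= n -> d (b i) (b j) <= C * (j - i).
Proof.
move=> [bC _] i j /andP[ij jn].
rewrite -(subnKC ij) in jn; rewrite -{1}(subnKC ij).
elim: (j - i) jn => [|k IHk] kn; first by rewrite addn0 d0.
have := dD (b i) (b (i + k)) (b (i + k).+1).
have := bC (i + k); have := IHk; rewrite !addnS; nia.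
Qed.

Lemma exp_dominates_linear A B : exists k0, forall k, k0 <= k -> A * k + B <= 2 ^ k.
Proof.
pose j := 2 * A + B.
have le2 i : i < 2 ^ i by apply: ltn_expl.
exists (2 * j) => k; elim: k => [|k IHk] jk.
  by have : j = 0 by [lia]; rewrite /j; lia.
case: (ltngtP (2 * j) k.+1) jk => // [jk _|kE _].
  have := IHk jk; rewrite expnS mulnS.
  have : A <= 2 ^ k; last by lia.
  by have := le2 k; rewrite /j in jk; lia.
by rewrite -kE mul2n -addnn expnD; have := le2 j; rewrite /j; nia.
Qed.

(** The hypothesis is [2 n <= C + D log_2 (A n + B)], written without
    logarithms. *)
Lemma log_bound A B C D : exists N, forall n,
  (forall k, A * n + B <= 2 ^ k -> 2 * n <= C + D * k) -> n <= N.
Proof.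
have [k0 k0P] := exp_dominates_linear (A * D.+1) (A * D.+1 + B).
exists (k0.+1 * D.+1 + C) => n nP; rewrite leqNgt; apply/negP => lt_n.
(* For this [k] the term [D * k] is at most [n], and [A * n + B] is linear in [k]. *)
pose k := n %/ D.+1.
have nk : n < k.+1 * D.+1 by have := divn_eq n D.+1; have := ltn_pmod n (ltn0Sn D); nia.
have kn : k * D.+1 <= n by apply: leq_divM.
have k0k : k0 <= k by rewrite leq_divRL //; nia.
have := k0P k k0k; have := nP k; nia.
Qed.

Section Stability.
Variables (delta C L E : nat).
Hypothesis fp : four_point delta.

(** The chain [y], [b i], ..., [b j], [z] avoids the ball of radius [D] about [x]
    although [x] lies between [y] and [z], and its length is linear in [D]; so
    [four_point_chain] makes [D] at most logarithmic in [D]. *)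
Lemma detour_length n b x y z i j D k : quasi_geodesic_seq C L E n b ->
  between y x z -> (forall l, l <= n -> D <= d x (b l)) ->
  i <= n -> j <= n ->
  2 * D + d y (b i) <= d x y + d x (b i) ->
  2 * D + d z (b j) <= d x z + d x (b j) ->
  d y (b i) <= D -> d z (b j) <= D -> d y z <= 4 * D ->
  6 * L * D + E + 2 <= 2 ^ k ->
  2 * D <= C + delta * k.
Proof.
move=> bP.
(* Reversing the roles of [y] and [z] reverses the stretch of [b]. *)
wlog ij : i j y z / i <= j => [IH|].
  move=> yxz bx iN jN yi zj yD zD yz kP; have [ij|ji] := leqP i j.
    exact: (IH i j y z).
  apply: (IH j i z y) => //; last by rewrite dC.
    by exact: ltnW.
  by move: yxz; rewrite /between (dC y x) (dC x z) (dC y z); lia.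
move=> yxz bx _ jN yi zj yD zD yz kP.
pose c l := if l == 0 then y else if l == (j - i).+2 then z else b (i + l.-1).
have := four_point_chain fp (k := k) (x := x) (m := (j - i).+2) (M := 2 * D - C) (c := c).
have -> : c 0 = y by [].
have -> : c (j - i).+2 = z by rewrite /c /= eqxx.
have yz0 : d x y + d x z = d y z by rewrite -yxz (dC y x).
have ji : j - i <= L * (6 * D) + E.
  have /bP.2 ji : i <= j <= n by rewrite ij.
  apply: leq_trans ji _; rewrite leq_add2r leq_mul2l; apply/orP; right.
  have := dD (b i) y (b j); have := dD y z (b j); rewrite (dC (b i) y); lia.
move=> H; suff : 2 * D - C + d y z <= d x y + d x z + delta * k by lia.
apply: H; first by lia.
case=> [|l] lij; rewrite /c /=; first by rewrite addn0; lia.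
rewrite eqSS; have -> : (l == (j - i).+1) = false by lia.
case: eqP => [[->]|ne]; first by rewrite subnKC // (dC (b j)); lia.
have lij' : i + l < n by lia.
have := bP.1 _ lij'; have := bx _ lij'; have := bx _ (ltnW lij').
have := dD (b (i + l)) x (b (i + l).+1); rewrite (dC (b (i + l)) x) addnS; lia.
Qed.

Lemma geodesic_near_quasi_geodesic : exists H, forall n b x,
  quasi_geodesic_seq C L E n b -> between (b 0) x (b n) ->
  exists2 i, i <= n & d x (b i) <= H.
Proof.
have [H HP] := log_bound (6 * L) (E + 2) C delta; exists H => n b x0 bP x0b.
(* [D] will be the largest distance to the sequence of a point of the interval. *)
pose far m := exists2 x, between (b 0) x (b n) & forall i, i <= n -> m <= d x (b i).
have exfar : exists m, `[< far m >] by exists 0; apply/asboolP; exists x0.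
have ub m : `[< far m >] -> m <= d (b 0) (b n).
  move=> /asboolP [x xb /(_ 0 (leq0n n))]; rewrite -xb (dC x); lia.
case: (ex_maxnP exfar ub) => D /asboolP [x xb xD] maxD.
have near u : between (b 0) u (b n) -> exists2 i, i <= n & d u (b i) <= D.
  move=> ub0; apply: contrapT => no.
  suff /asboolP /maxD : far D.+1 by rewrite ltnn.
  by exists u => // i iN; rewrite ltnNge; apply/negP => le; apply: no; exists i.
have DH : D <= H.
  apply: HP => k kP; rewrite addnA in kP.
  (* The points at distance [2 * D] on both sides of [x], or the ends of the
     interval if these are closer: going from them to the sequence costs at most [D],
     and this does not enter the ball of radius [D] about [x]. *)
  have [|y y1 y2] := dist_divide dP (x := x) (y := b 0) (m := minn (2 * D) (d x (b 0))).
    by lia.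
  have [|z z1 z2] := dist_divide dP (x := x) (y := b n) (m := minn (2 * D) (d x (b n))).
    by lia.
  have yzb : [/\ between (b 0) y (b n), between (b 0) z (b n) & between y x z].
    move: xb; rewrite /between (dC (b 0) x) (dC (b 0) y) (dC (b 0) z) (dC y x) => xb.
    have := dD (b 0) y (b n); have := dD (b 0) z (b n); have := dD y x z.
    have := dD y x (b n); have := dD z x (b 0); have := dD (b 0) y z.
    by rewrite (dC (b 0) y) (dC (b 0) z) (dC z x) (dC y x); split; lia.
  have [yb zb yxz] := yzb.
  have [i iN yi] : exists2 i, i <= n & d y (b i) <= D /\ 2 * D + d y (b i) <= d x y + d x (b i).
    have [big|small] := leqP (2 * D) (d x (b 0)).
      have [i iN yi] := near y yb; exists i => //; have := xD i iN; lia.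
    have <- : b 0 = y by apply/esym/(dist_eq0 dP); lia.
    by exists 0 => //; have := xD 0 (leq0n n); rewrite d0; lia.
  have [j jN zj] : exists2 j, j <= n & d z (b j) <= D /\ 2 * D + d z (b j) <= d x z + d x (b j).
    have [big|small] := leqP (2 * D) (d x (b n)).
      have [j jN zj] := near z zb; exists j => //; have := xD j jN; lia.
    have <- : b n = z by apply/esym/(dist_eq0 dP); lia.
    by exists n => //; have := xD n (leqnn n); rewrite d0; lia.
  apply: (detour_length (n := n) (b := b) (x := x) (y := y) (z := z)
           (i := i) (j := j)) => //; try by lia.
  by have := dD y x z; rewrite (dC y x); lia.
by have [i iN x0i] := near x0 x0b; exists i => //; apply: leq_trans DH.
Qed.
End Stability.

(** For [i > 0] take for [t i] the last time at which [g] is close to some [b j]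
    with [j <= i]; this is monotone by construction.  The point [g (t i).+1] is close
    to some [b k] with [k > i], so [b j] and [b k] are close, and the
    quasi-geodesic [b] has spent only a bounded time between [j] and [k]. *)
Lemma monotone_fellow_travel C L E C' H n m b g :
  quasi_geodesic_seq C L E n b ->
  (forall t, t < m -> d (g t) (g t.+1) <= C') ->
  g 0 = b 0 -> g m = b n ->
  (forall t, t <= m -> exists2 j, j <= n & d (g t) (b j) <= H) ->
  exists t : nat -> nat, [/\ t 0 = 0, t n = m \/ n = 0,
    forall i j, i <= j <= n -> t i <= t j <= m &
    forall i, i <= n -> d (b i) (g (t i)) <= H + C * (L * (2 * H + C') + E)].
Proof.
move=> bP gC g0 gm near.
pose P i t := exists2 j, j <= i & d (g t) (b j) <= H.
have exm i : exists t, [/\ t <= m, P i t & forall k, t < k <= m -> ~ P i k].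
  have [|t [_ tm Pt maxt]] := @last_true_upto (P i) 0 m (leq0n m); last by exists t.
  by exists 0 => //; rewrite g0 d0.
have [t tP] := choice exm.
exists (fun i => if i == 0 then 0 else t i); split=> //.
- case: eqP => [|_]; [by right|left].
  have [tm _ maxt] := tP n; apply/eqP; rewrite eqn_leq tm /= leqNgt.
  apply/negP => lt; apply: (maxt m); first by rewrite lt leqnn.
  by exists n => //; rewrite gm d0.
- move=> i j /andP[ij jn]; have [ti Pi maxi] := tP i; have [tj Pj maxj] := tP j.
  case: (i =P 0) => [_|i0]; first by case: ifP.
  have -> : (j == 0) = false by lia.
  rewrite tj andbT.
  rewrite leqNgt; apply/negP => lt; apply: (maxj (t i)); first by lia.
  by have [l li gl] := Pi; exists l => //; lia.
move=> i iN; case: eqP => [->|i0]; first by rewrite g0 d0.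
have [tm [j ji tj] maxt] := tP i.
have [k [ik kN jk]] : exists k, [/\ i <= k, k <= n & d (b j) (b k) <= 2 * H + C'].
  have [lt|ge] := ltnP (t i) m; last first.
    exists n; split=> //; have tE : t i = m by lia.
    by move: tj; rewrite tE gm (dC (b n)); lia.
  have [k kN gk] := near _ lt.
  have [ki|ik] := leqP k i; first by case: (maxt (t i).+1); [lia|exists k].
  exists k; split=> //; first exact: ltnW.
  have := dD (b j) (g (t i)) (b k); have := dD (g (t i)) (g (t i).+1) (b k).
  by have := gC _ lt; rewrite (dC (b j) (g _)); lia.
have kj := bP.2 j k (introT andP (conj (leq_trans ji ik) kN)).
have ij := quasi_geodesic_seq_lipschitz bP (introT andP (conj ji iN)).
have := dD (b i) (b j) (g (t i)); rewrite (dC (b i) (b j)) (dC (b j) (g _)).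
have : C * (i - j) <= C * (L * (2 * H + C') + E); last by lia.
by rewrite leq_mul2l; apply/orP; right; nia.
Qed.

(** A geodesic [s] with the same ends serves as intermediary: [g] travels along
    [s], and the points of [s] are near [b]. *)
Lemma quasi_geodesics_fellow_travel delta C L E : four_point delta ->
  exists R, forall n b m g,
  quasi_geodesic_seq C L E n b -> quasi_geodesic_seq C L E m g ->
  g 0 = b 0 -> g m = b n ->
  exists t : nat -> nat, [/\ t 0 = 0, t n = m \/ n = 0,
    forall i j, i <= j <= n -> t i <= t j <= m &
    forall i, i <= n -> d (b i) (g (t i)) <= R].
Proof.
move=> fp; have [H HP] := geodesic_near_quasi_geodesic C L E fp.
pose H' := H + C * (L * (2 * H + 1) + E).
exists ((H' + H) + C * (L * (2 * (H' + H) + C) + E)) => n b m g bP gP g0 gm.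
apply: (monotone_fellow_travel bP gP.1 g0 gm) => t tm.
have [s [s0 sl sP]] := geodesic_seq_ex (g 0) (g m).
have bet k : k <= d (g 0) (g m) -> between (g 0) (s k) (g m).
  by move=> kl; have := geodesic_seq_between sP kl; rewrite s0 sl.
have [|||k kl|t' [_ _ t'mono t'P]] :=
    @monotone_fellow_travel C L E 1 H m (d (g 0) (g m)) g s gP.
- by move=> k kl; rewrite sP; lia.
- by [].
- by [].
- exact: HP gP (bet k kl).
have t'le : t' t <= d (g 0) (g m) by have := t'mono t t; rewrite tm leqnn => /(_ isT)/andP[].
have [||j jn sj] := HP n b (s (t' t)) => //; first by have := bet _ t'le; rewrite g0 gm.
exists j => //; have := dD (g t) (s (t' t)) (b j); have := t'P t tm; rewrite -/H'; lia.
Qed.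
End DiscreteMetric.

(** * Deterministic automata *)

Section Determinization.
Variable A : finType.

Lemma regular_dfa (L : set (seq A)) : regular L ->
  exists (Q : finType) (q0 : Q) (step : Q -> A -> Q) (F : pred Q),
    forall w, L w <-> F (foldl step q0 w).
Proof.
move=> [M ->].
(* The subset construction. *)
pose step (X : {set state M}) a := [set q' | [exists q in X, edge q a q']].
pose F (X : {set state M}) := [exists q in X, q \in final M].
exists {set state M}, [set initial M], step, F => w.
suff H X : F (foldl step X w) <-> exists2 q, q \in X & accepts_from q w.
  rewrite H /=; split=> [?|[q /set1P -> //]].
  by exists (initial M) => //; exact: set11.
elim: w X => [|a w IHw] X /=.
  by split=> [/existsP[q /andP[qX qF]]|[q qX qF]]; [exists q|apply/existsP; exists q; rewrite qX].
rewrite IHw; split=> [[q' + acc]|[q qX [q' e acc]]].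
  rewrite inE => /existsP[q /andP[qX e]]; exists q => //; by exists q'.
by exists q' => //; rewrite inE; apply/existsP; exists q; rewrite qX.
Qed.

Lemma dfa_regular (Q : finType) (q0 : Q) (step : Q -> A -> Q) (F : pred Q)
    (L : set (seq A)) :
  (forall w, L w <-> F (foldl step q0 w)) -> regular L.
Proof.
move=> LP; pose M := Automaton q0 [set q | F q] (fun q a q' => q' == step q a).
exists M; suff H w (q : state M) : accepts_from q w <-> F (foldl step q w).
  by apply/seteqP; split=> w; rewrite /= LP H.
elim: w q => [|a w IHw] q /=; first by rewrite inE.
split=> [[q' /eqP ->]|]; first by rewrite IHw.
by move=> acc; exists (step q a); rewrite ?IHw.
Qed.

Lemma regular_setC (L : set (seq A)) : regular L -> regular (~` L)%classic.
Proof.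
move=> /regular_dfa [Q [q0 [step [F LP]]]].
apply: (@dfa_regular Q q0 step (predC F)) => w /=; rewrite LP.
by split=> /negP.
Qed.

End Determinization.

(** * Word length *)

Section Words.
Variables (G : groupType) (S : {fset G}).
Implicit Types (w u v : seq (alphabet S)) (g h : G).

Lemma eval_nil : eval ([::] : seq (alphabet S)) = 1%g.
Proof. by rewrite /eval big_nil. Qed.

Lemma eval_cons (a : alphabet S) w : eval (a :: w) = (val a * eval w)%g.
Proof. by rewrite /eval big_cons. Qed.

Lemma eval1 (a : alphabet S) : eval [:: a] = val a.
Proof. by rewrite eval_cons eval_nil mulg1. Qed.

Lemma eval_cat u v : eval (u ++ v) = (eval u * eval v)%g.
Proof. by rewrite /eval big_cat. Qed.

Lemma alphabetV g : g \in alphabet S -> (g^-1)%g \in alphabet S.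
Proof.
rewrite !inE => /orP[gS|/imfsetP[s /= sS ->]].
  by apply/orP; right; apply/imfsetP; exists g.
by rewrite invgK sS.
Qed.

Definition word_inv w : seq (alphabet S) :=
  rev [seq FSetSub (alphabetV (valP a)) | a <- w].

Lemma size_word_inv w : size (word_inv w) = size w.
Proof. by rewrite size_rev size_map. Qed.

Lemma eval_word_inv w : eval (word_inv w) = ((eval w)^-1)%g.
Proof.
rewrite /word_inv; elim: w => [|a w IHw] /=; first by rewrite eval_nil invg1.
by rewrite rev_cons -cats1 eval_cat IHw eval1 eval_cons invgM.
Qed.

Definition is_length g n := exists2 w : seq (alphabet S), eval w = g & size w = n.

(** Junk value 0 on the elements that no word represents. *)
Definition len g : nat :=
  if pselect (exists n, `[< is_length g n >]) is left ex then ex_minn ex else 0.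

Hypothesis hS : generating S.

Lemma lenP g : is_length g (len g) /\ forall w : seq (alphabet S), eval w = g -> len g <= size w.
Proof.
rewrite /len; case: pselect => [ex|[]]; last first.
  by have [w wg] := hS g; exists (size w); apply/asboolP; exists w.
case: ex_minnP => n /asboolP gn minn; split=> // w wg.
by apply: minn; apply/asboolP; exists w.
Qed.

Lemma len_word g : exists2 w : seq (alphabet S), eval w = g & size w = len g.
Proof. by have [] := lenP g. Qed.

Lemma len_eval w : len (eval w) <= size w.
Proof. by have [_] := lenP (eval w); apply. Qed.

Lemma len1 : len 1%g = 0.
Proof. by have := len_eval [::]; rewrite eval_nil /=; case: (len _). Qed.

Lemma len_eq0 g : len g = 0 -> g = 1%g.
Proof.
by have [w <- <-] := len_word g => /size0nil ->; rewrite eval_nil.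
Qed.

Lemma lenM g h : len (g * h)%g <= len g + len h.
Proof.
have [u <- <-] := len_word g; have [v <- <-] := len_word h.
by rewrite -eval_cat -size_cat len_eval.
Qed.

Lemma lenV g : len (g^-1)%g = len g.
Proof.
have H x : len (x^-1)%g <= len x.
  have [u <- <-] := len_word x.
  by rewrite -eval_word_inv -(size_word_inv u) len_eval.
by apply/eqP; rewrite eqn_leq H -{1}(invgK g) H.
Qed.

Definition dist g h := len (g^-1 * h)%g.

Lemma dist1 g : dist 1%g g = len g.
Proof. by rewrite /dist invg1 mul1g. Qed.

Lemma distM g h k : dist (g * h)%g (g * k)%g = dist h k.
Proof. by rewrite /dist invgM -mulgA mulKg. Qed.

Lemma dist_mulr g h : dist g (g * h)%g = len h.
Proof. by rewrite /dist mulKg. Qed.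

Definition geodesic_word w := len (eval w) = size w.

Lemma geodesic_word_cat u v : geodesic_word (u ++ v) -> geodesic_word u /\ geodesic_word v.
Proof.
rewrite /geodesic_word eval_cat size_cat => uv.
by have := lenM (eval u) (eval v); have := len_eval u; have := len_eval v; lia.
Qed.

Lemma geodesic_word_infix u w : infix u w -> geodesic_word w -> geodesic_word u.
Proof.
by move=> /infixP[s [t ->]] /geodesic_word_cat[_ /geodesic_word_cat[]].
Qed.

Lemma dist_word g h :
  exists2 w : seq (alphabet S), geodesic_word w & (g * eval w = h)%g /\ size w = dist g h.
Proof.
have [w wE sw] := len_word (g^-1 * h)%g.
by exists w; rewrite /geodesic_word ?wE // mulVKg.
Qed.

Lemma word_metric : geodesic_metric dist.
Proof.
split=> [g|g h|g h|g h k|g h m].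
- by rewrite /dist mulVg len1.
- by move=> /len_eq0 gh; rewrite -[h](mulVKg g) gh mulg1.
- by rewrite /dist -lenV invgM invgK.
- by rewrite /dist -[X in (_ * X)%g](mulVKg h) mulgA lenM.
- move=> gh; have [w wg [wE sw]] := dist_word g h.
  have [] := @geodesic_word_cat (take m w) (drop m w); rewrite ?cat_take_drop //.
  move=> w1 w2; exists (g * eval (take m w))%g.
    by rewrite dist_mulr w1 size_takel // sw.
  rewrite -{1}wE -{2}(cat_take_drop m w) eval_cat mulgA dist_mulr w2 size_drop sw.
  by [].
Qed.

Definition word_point g w i := (g * eval (take i w))%g.

Lemma word_point_dist g w i j : i <= j ->
  dist (word_point g w i) (word_point g w j) = len (eval (take (j - i) (drop i w))).
Proof.
move=> ij; rewrite /word_point distM /dist -{1}(subnKC ij) takeD eval_cat mulKg.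
by [].
Qed.

Lemma word_point_geodesic g w : geodesic_word w ->
  geodesic_seq dist (size w) (word_point g w).
Proof.
move=> wg i j /andP[ij jw]; rewrite word_point_dist //.
have -> : geodesic_word (take (j - i) (drop i w)).
  apply: geodesic_word_infix wg; apply/infixP.
  by exists (take i w), (drop (j - i) (drop i w)); rewrite !cat_take_drop.
by rewrite size_take size_drop; case: ltnP; lia.
Qed.

Lemma between_geodesic_word (x u y : G) : between dist x u y ->
  exists w : seq (alphabet S), [/\ geodesic_word w, (x * eval w)%g = y &
    exists2 i, (i <= size w)%N & word_point x w i = u].
Proof.
move=> xuy.
have [w1 g1 [e1 s1]] := dist_word x u; have [w2 g2 [e2 s2]] := dist_word u y.
have wE : (x * eval (w1 ++ w2))%g = y by rewrite eval_cat mulgA e1.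
exists (w1 ++ w2); split=> //.
  by rewrite /geodesic_word -(dist_mulr x) wE size_cat s1 s2 xuy.
by exists (size w1); rewrite ?size_cat ?leq_addr // /word_point take_size_cat.
Qed.

Lemma word_of_seq n (c : nat -> G) :
  (forall i, i < n -> dist (c i) (c i.+1) = 1) ->
  exists2 w : seq (alphabet S), size w = n & forall i, i <= n -> word_point (c 0) w i = c i.
Proof.
elim: n => [|n IHn] cP.
  by exists [::] => // -[] // _; rewrite /word_point eval_nil mulg1.
have [|w sw wP] := IHn; first by move=> i iN; apply: cP; lia.
have [u uE su] := len_word ((c n)^-1 * c n.+1)%g.
rewrite [len _](cP n) // in su.
exists (w ++ u); first by rewrite size_cat sw su addn1.
move=> i; rewrite leq_eqVlt => /orP[/eqP ->|iN].
  rewrite /word_point take_oversize ?size_cat ?sw ?su ?addn1 // eval_cat uE mulgA.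
  have := wP n (leqnn n); rewrite /word_point take_oversize ?sw // => ->.
  by rewrite mulVKg.
by rewrite -(wP i iN) /word_point takel_cat ?sw.
Qed.

End Words.

(** The constant is the largest length of a generator. *)
Lemma len_bilipschitz (G : groupType) (S S' : {fset G}) :
  generating S -> generating S' ->
  exists C, forall g, len S g <= C * len S' g.
Proof.
move=> hS hS'; exists (\max_(a : alphabet S') len S (val a)) => g.
have [w <- <-] := len_word hS' g.
elim: w => [|a w IHw]; first by rewrite eval_nil len1.
rewrite eval_cons mulnS; apply: leq_trans (lenM hS _ _) _.
by apply: leq_add => //; apply: (leq_bigmax_cond (F := fun a => len S (val a))).
Qed.

(** * Pumping minimal non-quasigeodesic words *)

Lemma cat_eq_split (A : Type) (a b c e : seq A) : a ++ b = c ++ e -> size a <= size c ->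
  exists2 s, c = a ++ s & b = s ++ e.
Proof.
move=> E ac; exists (drop (size a) c).
  have := congr1 (take (size a)) E; rewrite take_size_cat // takel_cat // => aE.
  by rewrite {1}aE cat_take_drop.
have := congr1 (drop (size a)) E; rewrite drop_size_cat // drop_cat.
by case: ltngtP ac => // ->; rewrite subnn drop0 drop_size.
Qed.

Section Infix.
Variable A : eqType.
Implicit Types (u v w : seq A).

Lemma infix_cat u a b : infix u (a ++ b) ->
  [\/ infix u a, infix u b | exists a1 a2 b1 b2,
     [/\ a = a1 ++ a2, b = b1 ++ b2 & u = a2 ++ b1]].
Proof.
move=> /infixP[p [t E]].
have [ap|pa] := leqP (size a) (size p).
  have [s _ bE] := cat_eq_split E ap.
  by apply: Or32; apply/infixP; exists s, t.
have [s aE utE] := cat_eq_split (esym E) (ltnW pa).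
have [us|su] := leqP (size u) (size s).
  have [r sE _] := cat_eq_split utE us.
  by apply: Or31; apply/infixP; exists p, r; rewrite aE sE.
have [r uE bE] := cat_eq_split (esym utE) (ltnW su).
by apply: Or33; exists p, s, r, t.
Qed.

Lemma infix_catl u a b : infix u a -> infix u (a ++ b).
Proof. by move=> /infixP[p [t ->]]; apply/infixP; exists p, (t ++ b); rewrite !catA. Qed.

Lemma infix_catr u a b : infix u b -> infix u (a ++ b).
Proof. by move=> /infixP[p [t ->]]; apply/infixP; exists (a ++ p), t; rewrite !catA. Qed.

(** An infix that meets both [a] and [c] contains [b]. *)
Lemma infix_cat3 u a b c : infix u (a ++ b ++ c) -> size u <= size b ->
  infix u (a ++ b) \/ infix u (b ++ c).
Proof.
rewrite catA => /infix_cat[uab|uc|]; [by left|by right; apply: infix_catr|].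
move=> [s1 [s2 [c1 [c2 [abE -> ->]]]]]; rewrite size_cat => le.
have [|s _ bE] := cat_eq_split abE.
  by have := congr1 size abE; rewrite !size_cat; lia.
by right; apply/infixP; exists s, c2; rewrite bE -!catA.
Qed.

Lemma infix_proper u a w b : infix u (a :: rcons w b) ->
  [\/ u = a :: rcons w b, infix u (rcons w b) | infix u (a :: w)].
Proof.
move=> /infixP[[|a' p] [t]]; last by case=> _ E; apply: Or32; apply/infixP; exists p, t.
case/lastP: t => [|t b']; first by rewrite cats0 cat0s => ->; apply: Or31.
rewrite cat0s -rcons_cat -rcons_cons => /rcons_inj[E _].
by apply: Or33; apply/infixP; exists [::], t.
Qed.

End Infix.

Lemma pigeonhole (T : finType) (f : nat -> T) :
  exists i j, [/\ i < j, j <= #|T| & f i = f j].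
Proof.
apply: contrapT => no.
have inj : injective (fun i : 'I_(#|T|.+1) => f i).
  move=> i j fij; apply/val_inj; case: (ltngtP i j) => // ij; case: no.
    by exists i, j; split=> //; rewrite -ltnS ltn_ord.
  by exists j, i; split=> //; rewrite -ltnS ltn_ord.
by have := leq_card _ inj; rewrite card_ord ltnn.
Qed.

Lemma foldl_pump (Q A : Type) (step : Q -> A -> Q) q w k :
  foldl step q w = q -> foldl step q (flatten (nseq k w)) = q.
Proof. by move=> qw; elim: k => //= k IHk; rewrite foldl_cat qw. Qed.

Section QuasiWords.
Variables (G : groupType) (S : {fset G}).
Hypothesis hS : generating S.
Local Notation word := (seq (alphabet S)).
Local Notation len := (len S).
Local Notation dist := (dist S).
Implicit Types (u v w : word).

(** For [q > 0] these are the [(p/q, E/q)]-quasigeodesic words; without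
    denominators the condition only involves natural numbers. *)
Definition quasi_word p q E w :=
  forall u, infix u w -> q * size u <= p * len (eval u) + E.

Lemma quasi_word_infix p q E u w : infix u w -> quasi_word p q E w -> quasi_word p q E u.
Proof. by move=> uw H v vu; apply: H; exact: infix_trans vu uw. Qed.

Lemma quasi_word_geodesic w : quasi_word 1 1 0 w <-> geodesic_word w.
Proof.
split=> [/(_ w (infix_refl w))|wg u uw].
  by have := len_eval hS w; rewrite /geodesic_word; lia.
by have := geodesic_word_infix hS uw wg; rewrite /geodesic_word; lia.
Qed.

Lemma geodesic_quasi_word w : geodesic_word w -> quasi_word 3 1 0 w.
Proof.
by move=> wg u uw; have := geodesic_word_infix hS uw wg; rewrite /geodesic_word; lia.
Qed.

Hypothesis reg_geodesic : regular [set w : word | quasi_word 1 1 0 w].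
Hypothesis reg_quasi : regular [set w : word | quasi_word 3 1 0 w].

Definition minimal_bad w :=
  ~ quasi_word 3 1 0 w /\ forall v, infix v w -> size v < size w -> quasi_word 3 1 0 v.

(** If [g] is long, the triples of automaton states reached on [x ++ g'], on
    [x ++ g'] without its first letter, and on [g'] repeat for two nonempty proper
    prefixes [g'] of [g].  Repeating the infix [y] between them [k] times leaves
    the whole word bad, while the word without its first or without its last
    letter stays good: so the inequality fails for the whole word.  But the
    powers of [y] stay geodesic, which makes the whole word nearly geodesic once
    [y] is repeated often enough. *)
Lemma minimal_bad_pump x g z : minimal_bad (x ++ g ++ z) -> geodesic_word g ->
  forall (Q1 Q3 : finType) (s1 : Q1) (s3 : Q3) step1 step3 (F1 : pred Q1) (F3 : pred Q3),
  (forall w, quasi_word 1 1 0 w <-> F1 (foldl step1 s1 w)) ->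
  (forall w, quasi_word 3 1 0 w <-> F3 (foldl step3 s3 w)) ->
  size g <= #|{: Q3 * Q3 * Q1}|.+1.
Proof.
move=> [bad min] gg Q1 Q3 s1 s3 step1 step3 F1 F3 L1 L3.
rewrite leqNgt; apply/negP => large.
pose f i := (foldl step3 s3 (x ++ take i.+1 g),
             foldl step3 s3 (behead (x ++ take i.+1 g)),
             foldl step1 s1 (take i.+1 g)).
have [i [j [ij jN [f1 f2 f3]]]] := pigeonhole f.
have jg : j.+1 < size g by apply: leq_ltn_trans large; rewrite ltnS.
pose p := take i.+1 g; pose y := take (j - i) (drop i.+1 g); pose r := drop j.+1 g.
have jE : j.+1 = i.+1 + (j - i) by lia.
have py : take j.+1 g = p ++ y by rewrite jE takeD.
have gE : g = p ++ y ++ r by rewrite catA -py cat_take_drop.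
have y_gt0 : 0 < size y.
  by rewrite size_takel ?size_drop; lia.
have r_gt0 : 0 < size r by rewrite /r size_drop; lia.
have p_gt0 : 0 < size p by rewrite size_takel; lia.
rewrite py in f1 f2 f3; rewrite -/p in f1 f2 f3.
have [a [X XE]] : exists a X, x ++ p = a :: X.
  case E : (x ++ p) => [|a X]; last by exists a, X.
  by have := congr1 size E; rewrite size_cat /=; lia.
have [Z [b ZE]] : exists Z b, r ++ z = rcons Z b.
  case/lastP E : (r ++ z) => [|Z b]; last by exists Z, b.
  by have := congr1 size E; rewrite size_cat /=; lia.
have wE : x ++ g ++ z = (a :: X) ++ y ++ rcons Z b by rewrite -XE -ZE gE -!catA.
rewrite wE in bad min; rewrite catA XE in f1; rewrite catA XE /= in f2.
rewrite !foldl_cat in f1 f2 f3.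
have [yk ykE] : exists yk, forall k, yk k = flatten (nseq k y).
  by exists (fun k => flatten (nseq k y)).
have pump1 k : foldl step1 (foldl step1 s1 p) (yk k) = foldl step1 s1 p.
  by rewrite ykE foldl_pump.
have pump2 k : foldl step3 (foldl step3 s3 X) (yk k) = foldl step3 s3 X.
  by rewrite ykE foldl_pump.
have pump3 k : foldl step3 (foldl step3 s3 (a :: X)) (yk k) = foldl step3 s3 (a :: X).
  by rewrite ykE foldl_pump.
have geo k : geodesic_word (yk k).
  have : quasi_word 1 1 0 (p ++ yk k ++ r).
    rewrite L1 !foldl_cat pump1 f3 -!foldl_cat -L1 -gE.
    exact/quasi_word_geodesic.
  move/quasi_word_geodesic/(geodesic_word_infix hS); apply; apply/infixP.
  by exists p, r.
have good1 k : quasi_word 3 1 0 (X ++ yk k ++ rcons Z b).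
  rewrite L3 !foldl_cat pump2 f2 -!foldl_cat -L3; apply: min; last by [].
  by apply/infixP; exists [:: a], [::]; rewrite cats0.
have good2 k : quasi_word 3 1 0 ((a :: X) ++ yk k ++ Z).
  rewrite L3 !foldl_cat pump3 f1 -!foldl_cat -L3; apply: min.
    by apply/infixP; exists [::], [:: b]; rewrite -cats1 -!catA.
  by rewrite !size_cat size_rcons !addnS.
have badk k : ~ quasi_word 3 1 0 ((a :: X) ++ yk k ++ rcons Z b).
  by rewrite L3 !foldl_cat pump3 f1 -!foldl_cat -L3.
(* The ends have total length [m = size (a :: X) + size (rcons Z b)], and badness
   gives [3 * (k * size y - m) < k * size y + m]; this fails as soon as
   [2 * m <= k * size y]. *)
have [k kE] : exists k, k = 2 * (size (a :: X) + size (rcons Z b)) + 1 by eexists.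
have wkE : (a :: X) ++ yk k ++ rcons Z b = a :: rcons (X ++ yk k ++ Z) b.
  by rewrite !rcons_cat.
apply: (badk k) => u; rewrite wkE => /infix_proper[->|H|H].
- have := len_eval hS (a :: X); have := len_eval hS (rcons Z b).
  have := lenM hS (eval (a :: X))^-1%g (eval (a :: rcons (X ++ yk k ++ Z) b)).
  have := lenM hS ((eval (a :: X))^-1 * eval (a :: rcons (X ++ yk k ++ Z) b))%g
                  (eval (rcons Z b))^-1%g.
  have -> : ((eval (a :: X))^-1 * eval (a :: rcons (X ++ yk k ++ Z) b) *
             (eval (rcons Z b))^-1)%g = eval (yk k).
    rewrite -rcons_cons -cat_cons !rcons_cat !eval_cat mulKg.
    by rewrite mulgK.
  have yE : size (yk k) = k * size y.
    by rewrite ykE size_flatten /shape map_nseq sumn_nseq mulnC.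
  have -> : size (a :: rcons (X ++ yk k ++ Z) b) = size (a :: X) + (k * size y + size (rcons Z b)).
    by rewrite -wkE !size_cat yE.
  rewrite !lenV // geo yE.
  have : k <= k * size y by rewrite leq_pmulr.
  rewrite {1}kE; move: (k * size y) (size (a :: X)) (size (rcons Z b)).
  move: (len _) (len _) (len _) (len _); lia.
- by apply: (good1 k); rewrite -!rcons_cat.
- exact: (good2 k).
Qed.

Lemma minimal_bad_geodesic_infix : exists N, forall w g,
  minimal_bad w -> infix g w -> geodesic_word g -> size g <= N.
Proof.
have [Q1 [s1 [step1 [F1 L1]]]] := regular_dfa reg_geodesic.
have [Q3 [s3 [step3 [F3 L3]]]] := regular_dfa reg_quasi.
exists #|{: Q3 * Q3 * Q1}|.+1 => w g wbad /infixP[x [z wE]] gg; rewrite wE in wbad.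
exact: minimal_bad_pump wbad gg _ _ _ _ _ _ _ _ L1 L3.
Qed.

Fixpoint piecewise_geodesic n w :=
  if n is n'.+1 then
    exists u v, [/\ w = u ++ v, geodesic_word u & piecewise_geodesic n' v]
  else w = [::].

Lemma piecewise_geodesic_infix n N u w : infix u w -> piecewise_geodesic n w ->
  (forall g, infix g u -> geodesic_word g -> size g <= N) -> size u <= n * N.
Proof.
elim: n u w => [|n IHn] u w /=; first by move=> uw wE; move: uw; rewrite wE infixs0 => /eqP->.
move=> uw [s [t [wE sg tn]]] small; move: uw; rewrite wE => /infix_cat[us|ut|].
- by have := small u (infix_refl u) (geodesic_word_infix hS us sg); lia.
- by have := IHn u t ut tn small; lia.
move=> [s1 [s2 [t1 [t2 [sE tE uE]]]]]; rewrite uE size_cat mulSn; apply: leq_add.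
  apply: small; first by rewrite uE; apply: infix_catl; exact: infix_refl.
  by apply: geodesic_word_infix sg => //; rewrite sE; apply: infix_catr; exact: infix_refl.
apply: (IHn t1 t) => //; first by rewrite tE; apply: infix_catl; exact: infix_refl.
by move=> g gt1; apply: small; rewrite uE; exact: infix_catr.
Qed.

(** A shortest bad infix is a minimal bad word, so each of its at most [n]
    geodesic pieces has bounded length. *)
Lemma piecewise_local_to_global n : exists K, forall w, piecewise_geodesic n w ->
  (forall u, infix u w -> size u <= K -> quasi_word 3 1 0 u) -> quasi_word 3 1 0 w.
Proof.
have [N NP] := minimal_bad_geodesic_infix; exists (n * N) => w wn loc.
apply: contrapT => wbad.
pose bad m := exists2 u, infix u w & size u = m /\ ~ quasi_word 3 1 0 u.
have exb : exists m, `[< bad m >].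
  by exists (size w); apply/asboolP; exists w => //; exact: infix_refl.
case: (ex_minnP exb) => m /asboolP [u uw [um ubad]] min.
apply: (ubad); apply: loc => //; apply: piecewise_geodesic_infix (uw) wn _.
move=> g; apply: NP; split=> // v vu vsmall; apply: contrapT => vbad.
suff : m <= size v by rewrite -um leqNgt vsmall.
by apply: min; apply/asboolP; exists v => //; exact: infix_trans vu uw.
Qed.

End QuasiWords.

(** * From local-to-global quasigeodesics to thin triangles *)

Section LocalToGlobal.
Variables (G : groupType) (S : {fset G}) (K : nat).
Hypothesis hS : generating S.
Local Notation word := (seq (alphabet S)).
Local Notation len := (len S).
Local Notation dist := (dist S).
Implicit Types (u v w : word).

Hypothesis local_to_global : forall w, piecewise_geodesic 5 w ->
  (forall u, infix u w -> size u <= K -> quasi_word 3 1 0 u) -> quasi_word 3 1 0 w.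

Let dP := word_metric hS.
Let d0 := dist_refl dP.
Let dC := dist_sym dP.
Let dD := dist_triangle dP.

Lemma geodesic_word_nil : geodesic_word ([::] : word).
Proof. by rewrite /geodesic_word eval_nil len1. Qed.

(** Let [b] lead from [p] to [q], where [p] is a point of [a] closest to [q].
    For a point [s] of [a] and a point [r] of [b], [p] is also closest to [r], so
    [dist r p <= dist r s] and hence [dist s p <= 2 * dist r s].  This is the
    origin of the constant 3. *)
Lemma quasi_word_projectionl (a b : word) : geodesic_word a -> geodesic_word b ->
  (forall a1 a2, a = a1 ++ a2 -> size b <= len (eval (a2 ++ b))) ->
  quasi_word 3 1 0 (a ++ b).
Proof.
move=> ga gb ab u /infix_cat[ua|ub|].
- exact: (geodesic_quasi_word hS ga).
- exact: (geodesic_quasi_word hS gb).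
move=> [a1 [a2 [b1 [b2 [aE bE ->]]]]]; have := ab _ _ aE.
rewrite aE in ga; have [_ ga2] := geodesic_word_cat hS ga.
rewrite bE in gb *; have [gb1 gb2] := geodesic_word_cat hS gb.
rewrite catA eval_cat !size_cat; have := lenM hS (eval (a2 ++ b1)) (eval b2).
have := lenM hS (eval (a2 ++ b1)) (eval b1)^-1%g.
rewrite eval_cat mulgK lenV // ga2 gb1 gb2; lia.
Qed.

Lemma quasi_word_projectionr (b c : word) : geodesic_word b -> geodesic_word c ->
  (forall c1 c2, c = c1 ++ c2 -> size b <= len (eval (b ++ c1))) ->
  quasi_word 3 1 0 (b ++ c).
Proof.
move=> gb gc bc u /infix_cat[ub|uc|].
- exact: (geodesic_quasi_word hS gb).
- exact: (geodesic_quasi_word hS gc).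
move=> [b1 [b2 [c1 [c2 [bE cE ->]]]]]; have := bc _ _ cE.
rewrite cE in gc; have [gc1 _] := geodesic_word_cat hS gc.
rewrite bE in gb *; have [gb1 gb2] := geodesic_word_cat hS gb.
rewrite -catA eval_cat !size_cat; have := lenM hS (eval b1) (eval (b2 ++ c1)).
have := lenM hS (eval b2)^-1%g (eval (b2 ++ c1)).
rewrite eval_cat mulKg lenV // gc1 gb1 gb2; lia.
Qed.

(** The path [b] is a shortest one between the paths [a] and [c] that it
    joins. *)
Definition bridge (a b c : word) := forall a1 a2 c1 c2 : word, a = a1 ++ a2 -> c = c1 ++ c2 ->
  size b <= len (eval (a2 ++ b ++ c1)).

(** Infixes of length at most [K] cannot meet both [a] and [c], and [b] projects
    to each of them. *)
Lemma quasi_word_bridge (a b c : word) :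
  geodesic_word a -> geodesic_word b -> geodesic_word c ->
  K <= size b -> bridge a b c -> quasi_word 3 1 0 (a ++ b ++ c).
Proof.
move=> ga gb gc Kb br; apply: local_to_global.
  exists a, (b ++ c); split=> //; exists b, c; split=> //.
  exists c, [::]; rewrite cats0; split=> //.
  (* Three geodesics count as five, the last two being empty. *)
  by do 2 (exists [::], [::]; split=> //; first exact: geodesic_word_nil).
move=> u uabc uK; have [uab|ubc] := infix_cat3 uabc (leq_trans uK Kb).
  apply: (quasi_word_infix uab); apply: quasi_word_projectionl => // a1 a2 aE.
  by have := br a1 a2 [::] c aE (erefl _); rewrite cats0.
apply: (quasi_word_infix ubc); apply: quasi_word_projectionr => // c1 c2 cE.
exact: br a [::] c1 c2 (esym (cats0 a)) cE.
Qed.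

Lemma quasi_word_double_bridge (a b c b' c' : word) :
  geodesic_word a -> geodesic_word b -> geodesic_word c ->
  geodesic_word b' -> geodesic_word c' ->
  K <= size b -> K <= size c -> K <= size b' ->
  bridge a b c -> bridge c b' c' ->
  quasi_word 3 1 0 (a ++ b ++ c ++ b' ++ c').
Proof.
move=> ga gb gc gb' gc' Kb Kc Kb' br br'; apply: local_to_global.
  exists a, (b ++ c ++ b' ++ c'); split=> //; exists b, (c ++ b' ++ c'); split=> //.
  exists c, (b' ++ c'); split=> //; exists b', c'; split=> //.
  by exists c', [::]; rewrite cats0.
move=> u; rewrite (catA a) => uw uK.
have [ul|ur] := infix_cat3 uw (leq_trans uK Kc).
  by apply: (quasi_word_infix ul); rewrite -catA; exact: quasi_word_bridge.
by apply: (quasi_word_infix ur); exact: quasi_word_bridge.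
Qed.

Definition labels w n (c : nat -> G) :=
  size w = n /\ forall i, i <= n -> word_point (c 0) w i = c i.

Lemma geodesic_labels n c : geodesic_seq dist n c ->
  exists2 w : word, labels w n c & geodesic_word w.
Proof.
move=> gc; have [|w sw wP] := @word_of_seq _ _ hS n c.
  by move=> i iN; rewrite gc; lia.
exists w => //; rewrite /geodesic_word sw.
have := wP n (leqnn n); rewrite /word_point take_oversize ?sw // => cE.
by rewrite -(dist_mulr S (c 0)) cE gc ?subn0 // leqnn.
Qed.

Lemma labels_suffix w n c w1 w2 : labels w n c -> w = w1 ++ w2 ->
  (c (size w1) * eval w2 = c n)%g.
Proof.
move=> [sw wP] wE; rewrite -(wP (size w1)); last by rewrite -sw wE size_cat leq_addr.
rewrite -(wP n) // /word_point (@take_oversize _ n w) ?sw //.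
by rewrite wE take_size_cat // eval_cat mulgA.
Qed.

Lemma labels_prefix w n c w1 w2 : labels w n c -> w = w1 ++ w2 ->
  (c 0 * eval w1 = c (size w1))%g.
Proof.
move=> [sw wP] wE; rewrite -(wP (size w1)); last by rewrite -sw wE size_cat leq_addr.
by rewrite /word_point wE take_size_cat.
Qed.

Lemma labels_all w n c : labels w n c -> (c 0 * eval w = c n)%g.
Proof. by move=> wc; have := labels_suffix wc (erefl : w = [::] ++ w). Qed.

Lemma labels_bridge n a m c wa wb wc :
  labels wa n a -> labels wc m c -> (a n * eval wb = c 0)%g ->
  (forall i j, i <= n -> j <= m -> size wb <= dist (a i) (c j)) ->
  bridge wa wb wc.
Proof.
move=> la lc ac far a1 a2 c1 c2 aE cE.
have an : size a1 <= n by rewrite -la.1 aE size_cat leq_addr.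
have cm : size c1 <= m by rewrite -lc.1 cE size_cat leq_addr.
have := far _ _ an cm; rewrite -(labels_prefix lc cE) -ac -(labels_suffix la aE).
by rewrite -!mulgA dist_mulr !eval_cat.
Qed.

Lemma geodesic_seq_rev n c : geodesic_seq dist n c ->
  forall k, k <= n -> geodesic_seq dist k (fun i => c (k - i)).
Proof. by move=> gc k kn i j ij; rewrite dC gc; lia. Qed.

Lemma geodesic_seq_shift n c k m : geodesic_seq dist n c -> k + m <= n ->
  geodesic_seq dist m (fun i => c (k + i)).
Proof. by move=> gc kn i j ij; rewrite gc; lia. Qed.

(** One step after leaving the [K]-neighbourhood of [b] the distance is exactly
    [K.+1], so the stretch of [a] outside that neighbourhood and the stretch of
    [b] between [j0] and [j2] are joined by a bridge of that length.  They form a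
    (3,0)-quasigeodesic whose ends are at distance at most [K.+1]. *)
Lemma excursion_length_monotone n a m b i0 i2 j0 j2 :
  geodesic_seq dist n a -> geodesic_seq dist m b ->
  i0 < i2 <= n -> j0 <= j2 <= m ->
  dist (a i0) (b j0) <= K -> dist (a i2) (b j2) <= K ->
  (forall k j, i0 < k < i2 -> j <= m -> K < dist (a k) (b j)) ->
  i2 - i0 <= 2 * K + 4.
Proof.
move=> ga gb /andP[i02 i2n] /andP[j02 j2m] d_0 d_2 far.
rewrite leqNgt; apply/negP => long.
have [wa la gwa] := geodesic_labels (geodesic_seq_rev (k := i2.-1 - i0.+1)
   (geodesic_seq_shift (k := i0.+1) (m := i2.-1 - i0.+1) ga ltac:(lia)) (leqnn _)).
have [wc lc gwc] := geodesic_labels (geodesic_seq_shift (k := j0) (m := j2 - j0) gb ltac:(lia)).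
have [wb gwb [bE sb]] := dist_word hS (a i0.+1) (b j0).
have sbE : size wb = K.+1.
  have lt := far i0.+1 j0 ltac:(lia) ltac:(lia); have := dD (a i0.+1) (a i0) (b j0).
  by rewrite sb (dC (a i0.+1) (a i0)) ga ?subSnn; lia.
have br : bridge wa wb wc.
  apply: labels_bridge la lc _ _; first by rewrite subnn !addn0.
  by move=> i j iN jN; rewrite sbE; apply: far; lia.
have Kb : K <= size wb by rewrite sbE.
have := quasi_word_bridge gwa gwb gwc Kb br (infix_refl _).
rewrite !size_cat sbE la.1 lc.1 !eval_cat.
have := labels_all la; have := labels_all lc; rewrite /= subn0 subnn !addn0 subnKC //.
rewrite -bE subnKC; last by lia.
move=> cE aE; have -> : len (eval wa * (eval wb * eval wc)) = dist (a i2.-1) (b j2).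
  by rewrite -cE -aE -!mulgA dist_mulr.
have := dD (a i2.-1) (a i2) (b j2); rewrite (ga i2.-1 i2); last by lia.
lia.
Qed.

Lemma excursion_length n a m b i0 i2 j0 j2 :
  geodesic_seq dist n a -> geodesic_seq dist m b ->
  i0 < i2 <= n -> j0 <= m -> j2 <= m ->
  dist (a i0) (b j0) <= K -> dist (a i2) (b j2) <= K ->
  (forall k j, i0 < k < i2 -> j <= m -> K < dist (a k) (b j)) ->
  i2 - i0 <= 2 * K + 4.
Proof.
move=> ga gb i02 j0m j2m d_0 d_2 far; have [j02|j20] := leqP j0 j2.
  by apply: excursion_length_monotone ga gb i02 _ d_0 d_2 far; rewrite j02.
apply: (excursion_length_monotone (j0 := m - j0) (j2 := m - j2) ga
         (geodesic_seq_rev gb (leqnn m)) i02); rewrite ?subKn //.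
  by lia.
by move=> k j kP jm; apply: far => //; exact: leq_subr.
Qed.

(** The times just before and just after [i] at which [a] is within [K] of [b]
    bound an excursion, so they are close to [i]. *)
Lemma near_between_close n a m b i i0 i2 j0 j2 :
  geodesic_seq dist n a -> geodesic_seq dist m b ->
  i0 <= i <= i2 -> i2 <= n -> j0 <= m -> j2 <= m ->
  dist (a i0) (b j0) <= K -> dist (a i2) (b j2) <= K ->
  exists2 j, j <= m & dist (a i) (b j) <= 3 * K + 4.
Proof.
move=> ga gb /andP[i0i ii2] i2n j0m j2m d_0 d_2.
pose close k := exists2 j, j <= m & dist (a k) (b j) <= K.
have [|k0 [i0k k0i [l0 l0m c0] max]] := @last_true_upto close i0 i i0i; first by exists j0.
have [|k2 [ik k2i [l2 l2m c2] min]] := @first_true_from close i i2 ii2; first by exists j2.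
have far k j : k0 < k < k2 -> j <= m -> K < dist (a k) (b j).
  move=> kP jm; rewrite ltnNge; apply/negP => le.
  have [ki|ik'] := leqP k i; first by apply: (max k); [lia|exists j].
  by apply: (min k); [lia|exists j].
exists l0 => //; have := dD (a i) (a k0) (b l0); rewrite (dC (a i) (a k0)) ga; last by lia.
have [k02|] := ltnP k0 k2; last by lia.
have := excursion_length ga gb _ l0m l2m c0 c2 far; rewrite k02 (leq_trans k2i i2n).
by move=> /(_ isT); lia.
Qed.

(** After [i] the path [a] has left the geodesic [b] for good, and before [i'] it
    has not yet been close to [c].  If [i' - i] were large, then going from the
    common end of [b] and [c] back along [b], over a bridge to [a], along [a],
    over a bridge to [c] and along [c] would be a closed (3,0)-quasigeodesic of
    positive length. *)
Lemma pentagon n a m b l c i j i' j' :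
  geodesic_seq dist n a -> geodesic_seq dist m b -> geodesic_seq dist l c ->
  b m = c l -> i < i' <= n -> j <= m -> j' <= l ->
  dist (a i) (b j) <= K -> dist (a i') (c j') <= K ->
  (forall k s, i < k <= n -> s <= m -> K < dist (a k) (b s)) ->
  (forall k s, k < i' -> s <= l -> K < dist (a k) (c s)) ->
  i' - i <= K + 2.
Proof.
move=> ga gb gc bc /andP[ii' i'n] jm j'l dij di'j' farb farc.
rewrite leqNgt; apply/negP => long.
have [wb lb gwb] := geodesic_labels (geodesic_seq_rev (k := m - j)
   (geodesic_seq_shift (k := j) (m := m - j) gb ltac:(lia)) (leqnn _)).
have [wa la gwa] := geodesic_labels
  (geodesic_seq_shift (k := i.+1) (m := i'.-1 - i.+1) ga ltac:(lia)).
have [wc lc gwc] := geodesic_labels (geodesic_seq_shift (k := j') (m := l - j') gc ltac:(lia)).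
have [v gv [vE sv]] := dist_word hS (b j) (a i.+1).
have [v' gv' [v'E sv']] := dist_word hS (a i'.-1) (c j').
have svK : size v = K.+1.
  have lt := farb i.+1 j ltac:(lia) jm; have := dD (a i.+1) (a i) (b j).
  by rewrite sv (dC (b j)) (dC (a i.+1) (a i)) ga ?subSnn; lia.
have sv'K : size v' = K.+1.
  have lt := farc i'.-1 j' ltac:(lia) j'l; have := dD (a i'.-1) (a i') (c j').
  by rewrite sv' ga; lia.
have br : bridge wb v wa.
  apply: labels_bridge lb la _ _; first by rewrite subnn !addn0.
  by move=> s k sm km; rewrite svK dC; apply: farb; lia.
have br' : bridge wa v' wc.
  apply: labels_bridge la lc _ _; first by rewrite addn0 subnKC //; lia.
  by move=> k s km sl; rewrite sv'K; apply: farc; lia.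
have Kv : K <= size v by rewrite svK.
have Kv' : K <= size v' by rewrite sv'K.
have Kwa : K <= size wa by rewrite la.1; lia.
have := quasi_word_double_bridge gwb gv gwa gv' gwc Kv Kwa Kv' br br' (infix_refl _).
rewrite !size_cat svK !eval_cat.
have := labels_all lb; have := labels_all la; have := labels_all lc.
rewrite /= subn0 subnn !addn0 !subnKC // ?ltnS; try lia.
rewrite -bc => cE aE bE.
have -> : (eval wb * (eval v * (eval wa * (eval v' * eval wc))) = 1)%g.
  apply: (mulgI (b m)); rewrite mulg1 -[RHS]cE -v'E -aE -vE -bE.
  by rewrite !mulgA.
by rewrite len1 //; lia.
Qed.

Lemma thin_triangles : thin_intervals dist (3 * K + 4).
Proof.
move=> x y z u xuy.
have [w [wg wE [i iN ai]]] := between_geodesic_word hS xuy.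
set n := size w in iN; pose a := word_point x w; rewrite -/(a i) in ai.
have aE : a n = y by rewrite /a /word_point take_size.
have ga : geodesic_seq dist n a by exact: word_point_geodesic.
have a0 : a 0 = x by rewrite /a /word_point take0 eval_nil mulg1.
have [b [b0 bm gb]] := geodesic_seq_ex dP x z.
have [c [c0 cl gc]] := geodesic_seq_ex dP y z.
set m := dist x z in bm gb; set l := dist y z in cl gc.
pose closeb k := exists2 j, j <= m & dist (a k) (b j) <= K.
pose closec k := exists2 j, j <= l & dist (a k) (c j) <= K.
have cb0 : closeb 0 by exists 0; rewrite // a0 b0 d0.
have ccn : closec n by exists 0; rewrite // aE c0 d0.
have [i1 [_ i1n [j1 j1m ab1] max]] := last_true_upto (leq0n n) cb0.
have [i2 [_ i2n [j2 j2l ac2] min]] := first_true_from (leq0n n) ccn.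
have onb j : j <= m -> between dist x (b j) z.
  by move=> jm; have := geodesic_seq_between gb jm; rewrite b0 bm.
have onc j : j <= l -> between dist y (c j) z.
  by move=> jl; have := geodesic_seq_between gc jl; rewrite c0 cl.
have [ii1|i1i] := leqP i i1.
  have [||j jm ij] := near_between_close (i := i) (i0 := 0) ga gb _ i1n (leq0n m) j1m _ ab1.
  - by rewrite ii1 (leq0n i).
  - by rewrite a0 b0 d0.
  by exists (b j); [left; exact: onb|rewrite -ai].
have [i2i|ii2] := leqP i2 i.
  have [||j jl ij] := near_between_close (i := i) ga gc _ (leqnn n) j2l (leq0n l) ac2.
  - by rewrite i2i.
  - by rewrite aE c0 d0.
  by exists (c j); [right; exact: onc|rewrite -ai].
have i12 : i2 - i1 <= K + 2.
  apply: (pentagon ga gb gc _ _ j1m j2l ab1 ac2); [by rewrite bm cl|by lia| |].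
    by move=> k s kP sm; rewrite ltnNge; apply/negP => le; apply: (max k kP); exists s.
  by move=> k s kP sl; rewrite ltnNge; apply/negP => le; apply: (min k kP); exists s.
exists (b j1); first by left; exact: onb.
have := dD (a i) (a i1) (b j1); rewrite (dC (a i) (a i1)) ga; last by lia.
by rewrite ai; lia.
Qed.

End LocalToGlobal.

Lemma regular_four_point (G : groupType) (S : {fset G}) : generating S ->
  regular [set w : seq (alphabet S) | quasi_word 1 1 0 w] ->
  regular [set w : seq (alphabet S) | quasi_word 3 1 0 w] ->
  exists delta, four_point (dist S) delta.
Proof.
move=> hS r1 r3; have [K KP] := piecewise_local_to_global hS r1 r3 5.
exists (6 * (3 * K + 4) + 2).
exact: thin_intervals_four_point (word_metric hS) _ (thin_triangles hS KP).
Qed.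

(** * An automaton for the words that are not quasigeodesic *)

(** Words over [S] are quasi-geodesic sequences for the hyperbolic metric of
    [S0], and so are the geodesics of [S]. *)
Lemma quasi_words_fellow_travel (G : groupType) (S0 S : {fset G}) delta p q E :
  generating S0 -> generating S -> four_point (dist S0) delta -> 0 < q <= p ->
  exists R, forall u v : seq (alphabet S),
    quasi_word p q E u -> geodesic_word v -> eval v = eval u ->
    exists t : nat -> nat, [/\ t 0 = 0, t (size u) = size v \/ size u = 0,
      forall i j, i <= j <= size u -> t i <= t j <= size v &
      forall i, i <= size u ->
        dist S (word_point 1 u i) (word_point 1 v (t i)) <= R].
Proof.
move=> hS0 hS fp /andP[q0 qp].
have [C CP] := len_bilipschitz hS0 hS; have [C' C'P] := len_bilipschitz hS hS0.
have dP := word_metric hS0.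
have [R RP] := quasi_geodesics_fellow_travel dP C (p * C') E fp.
have step (w : seq (alphabet S)) i : i < size w ->
    dist S0 (word_point 1 w i) (word_point 1 w i.+1) <= C.
  move=> iw; rewrite /dist; apply: leq_trans (CP _) _.
  rewrite -[X in _ <= X]muln1 leq_mul2l; apply/orP; right.
  rewrite -/(dist S _ _) word_point_dist //; apply: leq_trans (len_eval hS _) _.
  by rewrite size_take; case: ltnP; rewrite subSnn.
have quasi (w : seq (alphabet S)) : quasi_word p q E w ->
    quasi_geodesic_seq (dist S0) C (p * C') E (size w) (word_point 1 w).
  move=> wq; split=> [|i j /andP[ij jw]]; first exact: step.
  have := wq (take (j - i) (drop i w)); rewrite -(word_point_dist 1 w ij) => H.
  have {}H : q * (j - i) <= p * dist S (word_point 1 w i) (word_point 1 w j) + E.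
    rewrite -{1}(@size_takel (j - i) _ (drop i w)); last by rewrite size_drop; lia.
    apply: H; apply/infixP; exists (take i w), (drop (j - i) (drop i w)).
    by rewrite !cat_take_drop.
  have := C'P ((word_point 1 w i)^-1 * word_point 1 w j)%g.
  rewrite -/(dist S _ _) -/(dist S0 _ _) -mulnA; nia.
exists (C' * R) => u v uq vg vu.
have vq : quasi_geodesic_seq (dist S0) C (p * C') E (size v) (word_point 1 v).
  split=> [|i j ij]; first exact: step.
  have := C'P ((word_point 1 v i)^-1 * word_point 1 v j)%g.
  rewrite -/(dist S _ _) -/(dist S0 _ _) (word_point_geodesic hS 1 vg ij) -mulnA; nia.
have [||t [t0 tn tmono tR]] := RP _ _ _ _ (quasi u uq) vq.
- by rewrite /word_point !take0.
- by rewrite /word_point !take_size vu.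
exists t; split=> // i iu; rewrite /dist; apply: leq_trans (C'P _) _.
by rewrite leq_mul2l; apply/orP; right; exact: tR.
Qed.

Section BadWords.
Variables (G : groupType) (S : {fset G}) (p q E R : nat).
Hypothesis hS : generating S.
Local Notation word := (seq (alphabet S)).
Local Notation len := (len S).
Local Notation dist := (dist S).
Implicit Types (u v w : word).

Definition bad_word u := p * len (eval u) + E < q * size u.

(** The integers [q i - p (t i)] met along a shortest bad word are at least
    [- offset]; they are stored as natural numbers with this offset added. *)
Let offset := p * R + p + q.
Let bound := p * R + (E + p + q) + offset.

(** [None]: the bad infix has not started.  [Some None]: it has been found.
    [Some (Some (h, c))]: after [i] letters of the guessed infix, leading to the
    vertex [b], the run follows a path of length [l] from the start of the infix
    to the vertex [b * eval h], and [c = q * i - p * l + offset]. *)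
Definition bad_state : Type := option (option ({bseq R of alphabet S} * 'I_bound.+1)).
HB.instance Definition _ := Finite.on bad_state.

Definition bad_step (g : G) (c : nat) (s : alphabet S) (r : bad_state) : bool :=
  match r with
  | None => false
  | Some None => offset + E + p * len (g^-1 * val s)%g < c + q
  | Some (Some (h, c')) => c' + p * len (g^-1 * val s * eval h)%g == c + q
  end.

Definition bad_edge (r : bad_state) (s : alphabet S) (r' : bad_state) : bool :=
  match r with
  | None => (r' == None) || bad_step 1%g offset s r'
  | Some None => r' == Some None
  | Some (Some (h, c)) => bad_step (eval h) c s r'
  end.

Definition bad_automaton : automaton (alphabet S) :=
  Automaton (None : bad_state) [set Some None] bad_edge.

Local Notation accepts r w := (@accepts_from _ bad_automaton r w).

Lemma bad_step_length (g : G) (v : word) s x c c' :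
  c + p * len (eval v * g)%g <= q * size v + offset ->
  c' + p * len (g^-1 * val s * x)%g <= c + q ->
  c' + p * len (eval (v ++ [:: s]) * x)%g <= q * size (v ++ [:: s]) + offset.
Proof.
have := lenM hS (eval v * g)%g (g^-1 * val s * x)%g.
have -> : (eval v * g * (g^-1 * val s * x))%g = (eval (v ++ [:: s]) * x)%g.
  by rewrite eval_cat eval1 -!mulgA mulVKg.
rewrite size_cat /= addn1 mulnS.
move: (len _) (len _) (len _) => l1 l2 l3.
move=> /(leq_mul (leqnn p)); rewrite mulnDr; lia.
Qed.

(** The value kept by a run is a lower bound for [q * i - p * d], where [d] is
    the distance of the guessed vertex from the start, because the path followed
    so far is at least as long as [d]. *)
Lemma bad_step_sound w g c s r v : bad_step g c s r -> accepts r w ->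
  c + p * len (eval v * g)%g <= q * size v + offset ->
  exists2 u, infix u (v ++ s :: w) & bad_word u.
Proof.
have sink c0 g0 s0 v0 : offset + E + p * len (g0^-1 * val s0)%g < c0 + q ->
    c0 + p * len (eval v0 * g0)%g <= q * size v0 + offset -> bad_word (v0 ++ [:: s0]).
  move=> st inv; have := bad_step_length (x := 1%g) (s := s0) (c' := (offset + E).+1) inv.
  by rewrite !mulg1 /bad_word; move: (len _) (len _) st inv => l1 l2; lia.
elim: w g c s r v => [|s' w IHw] g c s [[[h c']|]|] v.
- by rewrite /= inE.
- by move=> st _ /(sink _ _ _ _ st) bad; exists (v ++ [:: s]); rewrite ?infix_refl.
- by [].
- move=> /eqP st [r st' acc] inv; have [] := IHw _ _ _ _ (v ++ [:: s]) st' acc.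
    by apply: (bad_step_length inv); rewrite st.
  by move=> u; rewrite -catA; exists u.
- move=> st _ /(sink _ _ _ _ st) bad; exists (v ++ [:: s]) => //.
  by apply/infixP; exists [::], (s' :: w); rewrite -catA.
- by [].
Qed.

Lemma bad_automaton_sound w : accepts None w -> exists2 u, infix u w & bad_word u.
Proof.
elim: w => [|s w IHw] /=; first by rewrite inE.
move=> [r /orP[/eqP ->|st] acc].
  by have [u uw bu] := IHw acc; exists u => //; exact: (infix_catr [:: s]).
have [|u uw bu] := bad_step_sound (v := [::]) st acc; last by exists u.
by rewrite eval_nil mulg1 len1 //; lia.
Qed.

Lemma accepts_sink w : accepts (Some None) w.
Proof. by elim: w => [|s w IHw] /=; [rewrite inE|exists (Some None)]. Qed.

Lemma accepts_skip v w : accepts None w -> accepts None (v ++ w).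
Proof. by move=> acc; elim: v => //= s v IHv; exists None. Qed.

Hypothesis fellow : forall u v : word,
    quasi_word p q (E + p + q) u -> geodesic_word v -> eval v = eval u ->
    exists t : nat -> nat, [/\ t 0 = 0, t (size u) = size v \/ size u = 0,
      forall i j, i <= j <= size u -> t i <= t j <= size v &
      forall i, i <= size u ->
        dist (word_point 1 u i) (word_point 1 v (t i)) <= R].

(** A run follows a geodesic with the ends of [u] along [t].  All proper infixes
    of [u] are good: for prefixes this bounds [q * i - p * t i] from above, and
    for suffixes, together with the badness of [u], from below. *)
Lemma bad_automaton_run u w : bad_word u ->
  (forall v, infix v u -> size v < size u -> ~ bad_word v) -> accepts None (u ++ w).
Proof.
move=> ubad min.
have u0 : 0 < size u by move: ubad; rewrite /bad_word; nia.
(* The word [u] itself exceeds the bound by at most [p + q], since dropping its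
   last letter gives a good word. *)
have uq : quasi_word p q (E + p + q) u.
  move=> v vu; have [lt|ge] := ltnP (size v) (size u).
    by have := min v vu lt; rewrite /bad_word; lia.
  have vE : v = u.
    have /infixP[a [b uE]] := vu; move: ge; rewrite {1}uE !size_cat.
    by case: a uE => [|??]; case: b => [|??] //= ->; rewrite ?cats0 ?size_cat //=; lia.
  rewrite vE; case/lastP: u {vE vu ge ubad u0} min => [|u s] min; first by rewrite muln0.
  have ubad : ~ bad_word u.
    by apply: min; rewrite ?size_rcons // -cats1; apply/infix_catl/infix_refl.
  have := lenM hS (eval (rcons u s)) (eval [:: s])^-1%g.
  have := len_eval hS [:: s]; move: ubad.
  by rewrite lenV // -cats1 eval_cat mulgK size_cat /bad_word /=; nia.
have [v vE sv] := len_word hS (eval u).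
have vg : geodesic_word v by rewrite /geodesic_word vE sv.
have [t [t0 tn tmono tR]] := fellow uq vg vE.
have {}tn : t (size u) = size v by case: tn => // uE; lia.
set n := size u in u0 tn tmono tR *.
pose b i := word_point 1 u i; pose x i := word_point 1 v (t i).
have tv i : i <= n -> t i <= size v by move=> iN; have := tmono i n; rewrite iN leqnn tn; lia.
have dP := word_metric hS.
have d_x i j : i <= j -> j <= n -> dist (x i) (x j) = t j - t i.
  move=> ij jn; rewrite /x word_point_geodesic //.
  by apply: tmono; rewrite ij.
have xE i : i = 0 \/ i = n -> x i = b i.
  by rewrite /x /b /word_point => -[]->; rewrite ?t0 ?tn ?take0 ?take_size ?vE.
have bu i : i <= n -> q * i <= p * (t i + R) + (E + p + q) /\
                      q * (n - i) <= p * (R + (size v - t i)) + (E + p + q).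
  move=> iN; have bR := tR i iN.
  have infq k l : k <= l <= n -> q * (l - k) <= p * dist (b k) (b l) + (E + p + q).
    move=> /andP[kl ln]; rewrite word_point_dist //.
    rewrite -{1}(@size_takel (l - k) _ (drop k u)); last by rewrite size_drop -/n; lia.
    apply: uq; apply/infixP; exists (take k u), (drop (l - k) (drop k u)).
    by rewrite !cat_take_drop.
  have := infq 0 i iN; have := infq i n; rewrite iN leqnn => /(_ isT).
  have := dist_triangle dP (b 0) (x i) (b i).
  have := dist_triangle dP (b i) (x i) (b n).
  rewrite -/(b i) -/(x i) in bR; rewrite (dist_sym dP (x i) (b i)).
  rewrite -(xE 0) -?(xE n); try by [left|right].
  rewrite !d_x // tn t0 !subn0 => le1 le2 q1 q2; split.
    apply: leq_trans q2 _; rewrite leq_add2r leq_mul2l; apply/orP; right; lia.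
  apply: leq_trans q1 _; rewrite leq_add2r leq_mul2l; apply/orP; right; lia.
have [h hP] : exists h : nat -> {bseq R of alphabet S},
    forall i, i <= n -> eval (h i) = ((b i)^-1 * x i)%g.
  suff /choice [h hP] : forall i, exists h : {bseq R of alphabet S},
      i <= n -> eval h = ((b i)^-1 * x i)%g by exists h.
  move=> i; have [iN|] := leqP i n; last by exists [bseq].
  have [y yE sy] := len_word hS ((b i)^-1 * x i)%g.
  have yR : size y <= R by rewrite sy; exact: tR.
  by exists (Bseq yR).
have next i s0 : i < n -> (((b i)^-1 * x i)^-1 * val (nth s0 u i))%g = ((x i)^-1 * b i.+1)%g.
  move=> iN; rewrite /b /word_point (take_nth s0) // -cats1 eval_cat eval1.
  by rewrite invgM invgK !mulgA.
(* From the vertex [b i] the run can be completed on the last [k.+1] letters. *)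
have main k i c : n - i = k.+1 -> c + p * t i = q * i + offset ->
    forall s0, exists2 r, bad_step ((b i)^-1 * x i)%g c (nth s0 u i) r &
      accepts r (drop i.+1 u ++ w).
  elim: k i c => [|k IHk] i c ik cE s0; (have iN : i < n by lia).
    exists (Some None); last exact: accepts_sink.
    have nE : i.+1 = n by lia.
    rewrite /bad_step next // nE -(xE n (or_intror (erefl n))) -/(dist _ _) d_x ?tn //; last by lia.
    have := tv i (ltnW iN); move: ubad; rewrite /bad_word -vE vg -/n -nE mulnS => ubad' ti.
    have : p * (size v - t i) + p * t i = p * size v by rewrite -mulnDr subnK.
    by lia.
  have [lo hi] := bu i.+1 iN.
  have ti : t i <= t i.+1 by have /andP[] := tmono i i.+1 (introT andP (conj (leqnSn i) iN)).
  have ti1 := tv i.+1 iN.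
  have tR1 : p * t i.+1 <= q * i.+1 + offset.
    rewrite /offset; have : p * (R + (size v - t i.+1)) + p * t i.+1 = p * R + p * size v.
      by rewrite -mulnDr -addnA subnK // mulnDr.
    move: ubad; rewrite /bad_word -vE vg -/n.
    have : q * (n - i.+1) + q * i.+1 = q * n by rewrite -mulnDr subnK.
    by lia.
  have cb : q * i.+1 + offset - p * t i.+1 < bound.+1.
    by move: lo; rewrite /bound mulnDr; lia.
  have [||r st acc] := IHk i.+1 (q * i.+1 + offset - p * t i.+1) _ _ s0; [by lia|by lia|].
  exists (Some (Some (h i.+1, Ordinal cb))).
    rewrite /bad_step next // hP // mulgA mulgK -/(dist _ _) d_x // ?iN //.
    have : p * (t i.+1 - t i) + p * t i = p * t i.+1 by rewrite -mulnDr subnK.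
    by have := mulnS q i; move=> ? ?; apply/eqP => /=; lia.
  rewrite (drop_nth s0 (n := i.+1)); last by rewrite -/n; lia.
  by exists r => //; rewrite /= hP.
have [s0 [u' uE]] : exists s0 u', u = s0 :: u'.
  by case: (u) (u0 : 0 < size u) => // s0 u'; exists s0, u'.
have [|| r st acc] := main n.-1 0 offset _ _ s0; [by lia|by rewrite t0 !muln0 addn0|].
have x0 : x 0 = b 0 by rewrite /x /b t0 /word_point !take0.
rewrite x0 mulVg uE /= drop0 in st acc; rewrite uE /=.
by exists r => //; rewrite st orbT.
Qed.

Lemma regular_quasi_word : regular [set w : word | quasi_word p q E w].
Proof.
have -> : ([set w : word | quasi_word p q E w] =
    ~` [set w | accepts (None : bad_state) w])%classic.
  apply/seteqP; split=> w /= wP.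
    by move/bad_automaton_sound => [u uw]; have := wP u uw; rewrite /bad_word; lia.
  move=> u uw; rewrite leqNgt; apply/negP => ub; apply: wP.
  pose bad m := exists2 u, infix u w & size u = m /\ bad_word u.
  have exb : exists m, `[< bad m >] by exists (size u); apply/asboolP; exists u.
  case: (ex_minnP exb) => m /asboolP [v vw [vm vbad]] min.
  have /infixP[a [b ->]] := vw; apply: accepts_skip; apply: bad_automaton_run => // y yv lt ybad.
  suff : m <= size y by rewrite -vm leqNgt lt.
  apply: min; apply/asboolP; exists y => //.
  exact: infix_trans yv vw.
by apply: regular_setC; exists bad_automaton.
Qed.

End BadWords.

Lemma four_point_regular (G : groupType) (S0 S : {fset G}) delta p q E :
  generating S0 -> generating S -> four_point (dist S0) delta -> 0 < q <= p ->
  regular [set w : seq (alphabet S) | quasi_word p q E w].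
Proof.
move=> hS0 hS fp qp.
have [R RP] := quasi_words_fellow_travel (E + p + q) hS0 hS fp qp.
exact: regular_quasi_word hS RP.
Qed.

(** * The metric of the Cayley graph *)

Local Open Scope classical_set_scope.
Local Open Scope ring_scope.

Section CayleyMetric.
Variables (R : realType) (G : groupType) (S : {fset G}).
Implicit Types (p q r : G -> R) (g h : G).

Lemma edge_point0 g h : edge_point g h (0 : R) = vertex R g.
Proof. by apply/funext => x; rewrite /edge_point; ring. Qed.

Lemma edge_point1 g h : edge_point g h (1 : R) = vertex R h.
Proof. by apply/funext => x; rewrite /edge_point; ring. Qed.

Lemma edge_point_sym g h (t : R) : edge_point g h t = edge_point h g (1 - t).
Proof. by apply/funext => x; rewrite /edge_point; ring. Qed.

Lemma edge_pointxx g (t : R) : edge_point g g t = vertex R g.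
Proof. by apply/funext => x; rewrite /edge_point; ring. Qed.

Lemma cayley_path_ge0 p q l : cayley_path S p q l -> 0 <= l.
Proof. by elim=> // *; rewrite addr_ge0. Qed.

Lemma cayley_path_cat p q r l l' :
  cayley_path S p q l -> cayley_path S q r l' -> cayley_path S p r (l + l').
Proof.
elim=> {p q l} [p|g s t t' q l sS t01 t'01 _ IH] qr; first by rewrite add0r.
by rewrite -addrA; apply: CayleyCons => //; exact: IH.
Qed.

Lemma cayley_path_sym p q l : cayley_path S p q l -> cayley_path S q p l.
Proof.
elim=> {p q l} [p|g s t t' q l sS t01 t'01 _ IH]; first exact: CayleyNil.
rewrite addrC; apply: (cayley_path_cat IH); rewrite distrC -[X in cayley_path _ _ _ X]addr0.
by apply: CayleyCons => //; exact: CayleyNil.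
Qed.

Lemma cayley_path_edge g (a : alphabet S) (t t' : R) : 0 <= t <= 1 -> 0 <= t' <= 1 ->
  cayley_path S (edge_point g (g * val a)%g t) (edge_point g (g * val a)%g t') `|t - t'|.
Proof.
have edge g' s (u u' : R) : s \in S -> 0 <= u <= 1 -> 0 <= u' <= 1 ->
    cayley_path S (edge_point g' (g' * s)%g u) (edge_point g' (g' * s)%g u') `|u - u'|.
  move=> sS u01 u'01; rewrite -[X in cayley_path _ _ _ X]addr0.
  by apply: CayleyCons => //; exact: CayleyNil.
move=> t01 t'01; have := valP a; rewrite inE => /orP[aS|/imfsetP[s /= sS aE]]; first exact: edge.
have E (u : R) : edge_point g (g * val a)%g u = edge_point (g * s^-1)%g (g * s^-1 * s)%g (1 - u).
  by rewrite edge_point_sym mulgVK (aE : val a = _).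
have -> : t - t' = (1 - t') - (1 - t) by ring.
by rewrite distrC !E; apply: edge => //; lra.
Qed.

Lemma in_cayley_graph_edge g (a : alphabet S) (t : R) : 0 <= t <= 1 ->
  in_cayley_graph S (edge_point g (g * val a)%g t).
Proof.
move=> t01; have := valP a; rewrite inE => /orP[aS|/imfsetP[s /= sS aE]].
  by right; exists g, (val a), t.
right; exists (g * s^-1)%g, s, (1 - t); split=> //; first by lra.
by rewrite edge_point_sym mulgVK (aE : val a = _).
Qed.

Lemma cayley_path_word g (w : seq (alphabet S)) :
  cayley_path S (vertex R g) (vertex R (g * eval w)%g) (size w)%:R.
Proof.
elim: w g => [|a w IHw] g; first by rewrite eval_nil mulg1; exact: CayleyNil.
rewrite eval_cons mulgA -natr1 addrC; apply: cayley_path_cat (IHw _).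
have := @cayley_path_edge g a (0 : R) 1; rewrite edge_point0 edge_point1 sub0r normrN normr1.
by apply; rewrite ?lexx ?ler01.
Qed.

Lemma near_vertex p : in_cayley_graph S p ->
  exists g, exists2 l, l <= 1 & cayley_path S p (vertex R g) l.
Proof.
case=> [[g ->]|[g [s [t [sS t01 ->]]]]].
  by exists g, 0; [exact: ler01|exact: CayleyNil].
exists g, `|t - 0|; first by rewrite subr0 ger0_norm; lra.
rewrite -[X in cayley_path _ _ X](edge_point0 g (g * s)%g) -[X in cayley_path _ _ _ X]addr0.
by apply: CayleyCons; rewrite ?lexx ?ler01 //; exact: CayleyNil.
Qed.

Hypothesis hS : generating S.
Local Notation dist := (dist S).
Local Notation len := (len S).

Lemma edge_point_lipschitz g h (t t' : R) x :
  edge_point g h t' x - edge_point g h t x <= `|t - t'|.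
Proof.
have -> : edge_point g h t' x - edge_point g h t x =
    (t - t') * (vertex R g x - vertex R h x) by rewrite /edge_point; ring.
rewrite (le_trans (ler_norm _)) // normrM ler_piMr // /vertex.
by case: (_ == _); case: (_ == _); rewrite ?subrr ?subr0 ?sub0r ?normrN ?normr0 ?normr1 ?ler01.
Qed.

(** The minimum of [dist x h + (1 - p x)] over the vertices [x] with [p x != 0]
    is the distance of the point [p] to the vertex [h]: from inside an edge the
    way leads through one of its ends, and [1 - p x] is the distance to the end
    [x].  Phrasing this with the coordinates of [p] makes it independent of the
    edge chosen to represent [p]. *)
Lemma cayley_path_lower_bound p q l h : cayley_path S p q l -> q = vertex R h ->
  exists2 x, p x != 0 & (dist x h)%:R + (1 - p x) <= l.
Proof.
have dP := word_metric hS.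
elim=> {p q l} [p ->|g s t t' q l sS t01 t'01 _ IH qE].
  exists h; first by rewrite /vertex eqxx oner_eq0.
  by rewrite /vertex eqxx (dist_refl dP) subrr addr0.
have [x x0 xl] := IH qE.
have sl : (len s <= 1)%N.
  have sA : s \in alphabet S by rewrite inE sS.
  by have := len_eval hS [:: FSetSub sA]; rewrite eval1.
(* If [x] leaves the support, the path starts at the other end of the edge. *)
have [px0|px0] := eqVneq (edge_point g (g * s)%g t x) 0; last first.
  by exists x => //; have := edge_point_lipschitz g (g * s)%g t t' x; lra.
have near y z : (dist y z <= 1)%N -> (dist y h)%:R <= (dist z h)%:R + 1 :> R.
  move=> yz; rewrite natr1 ler_nat; apply: leq_trans (dist_triangle dP y z h) _.
  by rewrite addnC -addn1 leq_add2l.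
have gs : (dist g (g * s) <= 1)%N by rewrite dist_mulr.
have sg : (dist (g * s) g <= 1)%N by rewrite (dist_sym dP).
move: px0 x0 xl; rewrite /edge_point /vertex.
have [xg|xg] := eqVneq x g; have [xgs|xgs] := eqVneq x (g * s)%g.
- by rewrite !mulr1 !subrK => /eqP; rewrite oner_eq0.
- rewrite !mulr0 !mulr1 !addr0 => t1 _ xl; have {}t1 : t = 1 by lra.
  exists (g * s)%g; rewrite eqxx t1 ?subrr ?mul0r ?add0r ?mulr1 ?oner_eq0 //.
  rewrite ger0_norm; last by lra.
  by have := near _ _ sg; rewrite -xg; lra.
- rewrite !mulr0 !mulr1 !add0r => t0 _ xl.
  exists g; rewrite eqxx t0 ?subr0 ?mul0r ?addr0 ?mulr1 ?oner_eq0 //.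
  rewrite sub0r normrN ger0_norm; last by lra.
  by have := near _ _ gs; rewrite -xgs; lra.
- by rewrite !mulr0 addr0 eqxx.
Qed.

Definition cayley_connected p q := exists l, cayley_path S p q l.

Lemma in_cayley_graph_connected p q :
  in_cayley_graph S p -> in_cayley_graph S q -> cayley_connected p q.
Proof.
move=> /near_vertex[g [l _ pg]] /near_vertex[h [l' _ qh]].
have [w wE] := hS (g^-1 * h)%g; have := cayley_path_word g w; rewrite wE mulVKg => gh.
exists (l + ((size w)%:R + l')); apply: cayley_path_cat pg _.
exact: cayley_path_cat gh (cayley_path_sym qh).
Qed.

Local Notation pm := (path_metric S).

Lemma path_lengths_lbound p q : has_lbound [set l | cayley_path S p q l].
Proof. by exists 0 => l /cayley_path_ge0. Qed.

Lemma path_metric_le p q l : cayley_path S p q l -> pm p q <= l.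
Proof. by move=> pq; apply: ge_inf => //; exact: path_lengths_lbound. Qed.

Lemma path_metric_ge0 p q : cayley_connected p q -> 0 <= pm p q.
Proof. by move=> pq; apply: lb_le_inf => // l /cayley_path_ge0. Qed.

Lemma path_metric_sym p q : pm p q = pm q p.
Proof.
rewrite /path_metric; congr (inf _).
by apply/seteqP; split=> l /= /cayley_path_sym.
Qed.

Lemma path_metric_triangle p q r : cayley_connected p q -> cayley_connected q r ->
  pm p r <= pm p q + pm q r.
Proof.
move=> pq qr; rewrite -lerBlDr; apply: lb_le_inf => // l pql.
rewrite lerBlDr addrC -lerBlDr; apply: lb_le_inf => // l' qrl'.
by rewrite lerBlDr addrC; apply: path_metric_le; exact: cayley_path_cat pql qrl'.
Qed.

Lemma path_metric_vertex g h : pm (vertex R g) (vertex R h) = (dist g h)%:R.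
Proof.
apply/eqP; rewrite eq_le; apply/andP; split.
  have [w _ [<- <-]] := dist_word hS g h.
  by apply: path_metric_le; exact: cayley_path_word.
have [w _ [<- _]] := dist_word hS g h.
apply: lb_le_inf; first by exists (size w)%:R; exact: cayley_path_word.
move=> l /cayley_path_lower_bound -/(_ _ erefl)[x]; rewrite /vertex.
by have [->|_] := eqVneq x g; rewrite ?eqxx //= subrr addr0.
Qed.

Lemma word_dist_len g : word_dist R S 1%g g = (len g)%:R.
Proof. by rewrite /word_dist path_metric_vertex dist1. Qed.

End CayleyMetric.

(** * Hyperbolicity of the Cayley graph and the four-point condition *)

Section RealFourPoint.
Variables (R : realType) (T : Type) (d : T -> T -> R) (delta : R).
Hypothesis dC : forall x y, d x y = d y x.
Hypothesis delta1 : 1 <= delta.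
Hypothesis fp : forall x y z w,
  d x z + d y w <= d x y + d z w + delta \/ d x z + d y w <= d x w + d y z + delta.

(** Choose the point of the segment at the same distance from [x] as [p], or its
    end [z] if the segment is too short. *)
Lemma near_geodesic_segment x z p C : geodesic_segment d x z C ->
  0 <= d x p -> d x p + d p z <= d x z + delta -> nbhd d (2 * delta) C p.
Proof.
move=> [l [c [l0 cx cz cd ->]]] xp0 pz.
have xzE : d x z = l by rewrite -cx -cz cd ?lexx ?l0 // sub0r normrN ger0_norm.
have on t : 0 <= t <= l -> d x (c t) = t /\ d (c t) z = l - t.
  move=> tl; rewrite -cx -cz !cd ?lexx ?l0 // sub0r normrN distrC !ger0_norm //; lra.
have [le|lt] := leP (d x p) l.
  have [xc cz'] := on (d x p) (introT andP (conj xp0 le)).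
  exists (c (d x p)); first by exists (d x p); rewrite //= xp0.
  have := fp p x (c (d x p)) z; rewrite xc cz' (dC p x) xzE; rewrite xzE in pz.
  by have := delta1 => ? []; lra.
exists (c l); first by exists l; rewrite /= ?l0 ?lexx.
by rewrite cz; have := delta1; lra.
Qed.

Lemma four_point_thin_side x y z A B C : (forall a b, 0 <= d a b) ->
  geodesic_segment d x y A -> geodesic_segment d y z B -> geodesic_segment d z x C ->
  A `<=` nbhd d (2 * delta) (B `|` C).
Proof.
move=> d_ge0 [l [c [l0 cx cy cd ->]]] gB gC _ [t /= tl <-].
have xyE : d x y = l by rewrite -cx -cy cd ?lexx ?l0 // sub0r normrN ger0_norm.
have [xc yc] : d x (c t) = t /\ d (c t) y = l - t.
  by rewrite -cx -cy !cd ?lexx ?l0 // sub0r normrN distrC !ger0_norm //; lra.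
have [h|h] := fp x (c t) y z.
  have [|||q Bq dq] := @near_geodesic_segment y z (c t) B; rewrite ?(dC y (c t)) //; [lra|].
  by exists q => //; left.
have [|||q Cq dq] := @near_geodesic_segment z x (c t) C; rewrite ?(dC z (c t)) //.
  by rewrite (dC (c t) x) (dC z x); lra.
by exists q => //; right.
Qed.

Lemma four_point_hyperbolic_space : (forall a b, 0 <= d a b) -> hyperbolic_space d.
Proof.
move=> d_ge0; exists (2 * delta); first by have := delta1; lra.
move=> x y z A B C gA gB gC; split.
- exact: four_point_thin_side d_ge0 gA gB gC.
- exact: four_point_thin_side d_ge0 gB gC gA.
- exact: four_point_thin_side d_ge0 gC gA gB.
Qed.

End RealFourPoint.

Section CayleyHyperbolic.
Variables (R : realType) (G : groupType) (S : {fset G}).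
Hypothesis hS : generating S.
Local Notation dist := (dist S).
Local Notation len := (len S).
Local Notation pm := (@path_metric R G S).
Local Notation cd := (@cayley_dist R G S).
Implicit Types (g h : G).

Lemma cayley_dist_sym (p q : cayley_graph R S) : cd p q = cd q p.
Proof. exact: path_metric_sym. Qed.

Lemma cayley_dist_ge0 (p q : cayley_graph R S) : 0 <= cd p q.
Proof. by apply/path_metric_ge0/in_cayley_graph_connected => //; exact: proj2_sig. Qed.

Lemma cayley_dist_triangle (p q r : cayley_graph R S) : cd p r <= cd p q + cd q r.
Proof.
by apply: path_metric_triangle; apply: in_cayley_graph_connected => //; exact: proj2_sig.
Qed.

Definition cayley_vertex g : cayley_graph R S :=
  exist _ (vertex R g) (or_introl (ex_intro _ g erefl)).

Lemma cayley_dist_vertex g h : cd (cayley_vertex g) (cayley_vertex h) = (dist g h)%:R.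
Proof. exact: path_metric_vertex. Qed.

Lemma near_cayley_vertex (p : cayley_graph R S) : exists g, cd p (cayley_vertex g) <= 1.
Proof.
have [g [l l1 pg]] := near_vertex (proj2_sig p).
by exists g; apply: le_trans (path_metric_le pg) l1.
Qed.

(** Every point of the Cayley graph is within 1 of a vertex, which changes each
    sum of two distances by at most 4. *)
Lemma four_point_cayley_hyperbolic delta : four_point dist delta -> hyperbolic_space cd.
Proof.
move=> fp; apply: (@four_point_hyperbolic_space _ _ _ (delta%:R + 8)).
- exact: cayley_dist_sym.
- by have := ler0n R delta; lra.
- move=> x y z w.
  have [x' xx'] := near_cayley_vertex x; have [y' yy'] := near_cayley_vertex y.
  have [z' zz'] := near_cayley_vertex z; have [w' ww'] := near_cayley_vertex w.
  have close p q p' q' : cd p (cayley_vertex p') <= 1 -> cd q (cayley_vertex q') <= 1 ->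
      cd p q <= (dist p' q')%:R + 2 /\ (dist p' q')%:R <= cd p q + 2.
    move=> pp' qq'; rewrite -cayley_dist_vertex.
    have := cayley_dist_triangle p (cayley_vertex p') q.
    have := cayley_dist_triangle (cayley_vertex p') (cayley_vertex q') q.
    have := cayley_dist_triangle (cayley_vertex p') p (cayley_vertex q').
    have := cayley_dist_triangle p q (cayley_vertex q').
    rewrite (cayley_dist_sym (cayley_vertex p') p) (cayley_dist_sym (cayley_vertex q') q).
    by split; lra.
  have [xz _] := close _ _ _ _ xx' zz'; have [yw _] := close _ _ _ _ yy' ww'.
  have [_ xy] := close _ _ _ _ xx' yy'; have [_ zw] := close _ _ _ _ zz' ww'.
  have [_ xw] := close _ _ _ _ xx' ww'; have [_ yz] := close _ _ _ _ yy' zz'.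
  have : ((dist x' z' + dist y' w')%:R <= (dist x' y' + dist z' w' + delta)%:R :> R) \/
         ((dist x' z' + dist y' w')%:R <= (dist x' w' + dist y' z' + delta)%:R :> R).
    rewrite !ler_nat; have := fp x' y' z' w'.
    by rewrite /maxn; case: ltnP => _ le; [right|left].
  by rewrite !natrD => -[h|h]; [left|right]; lra.
- exact: cayley_dist_ge0.
Qed.

(** The path in the Cayley graph that follows [w] from [g] at unit speed. *)
Definition word_path g (w : seq (alphabet S)) (t : R) : G -> R :=
  let k := Num.truncn t in
  edge_point (word_point g w k) (word_point g w k.+1) (t - k%:R).

Lemma word_pathE g w (k : nat) (t : R) : k%:R <= t <= k.+1%:R ->
  word_path g w t = edge_point (word_point g w k) (word_point g w k.+1) (t - k%:R).
Proof.
move=> /andP[kt]; rewrite le_eqVlt => /orP[/eqP ->|tk].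
  by rewrite /word_path natrK subrr edge_point0 -natr1 addrAC subrr add0r edge_point1.
by rewrite /word_path (truncn_def (n := k)) // kt.
Qed.

Lemma word_path_nat g w (k : nat) : word_path g w k%:R = vertex R (word_point g w k).
Proof. by rewrite /word_path natrK subrr edge_point0. Qed.

Lemma word_pointS g (w : seq (alphabet S)) k :
  word_point g w k.+1 = word_point g w k \/
  exists a : alphabet S, word_point g w k.+1 = (word_point g w k * val a)%g.
Proof.
have [wk|kw] := leqP (size w) k.
  by left; rewrite /word_point !take_oversize // leqW.
right; case: w kw => // a w kw; exists (nth a (a :: w) k).
by rewrite /word_point (take_nth a) // -cats1 eval_cat eval1 mulgA.
Qed.

Lemma word_path_in_graph g w (t : R) : 0 <= t -> in_cayley_graph S (word_path g w t).
Proof.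
move=> t0; rewrite /word_path; have /andP[lo hi] := truncn_itv t0.
have [->|[a ->]] := word_pointS g w (Num.truncn t).
  by left; eexists; rewrite edge_pointxx.
by apply: in_cayley_graph_edge; rewrite -natr1 in hi; lra.
Qed.

Lemma word_path_edge g w (k : nat) (s t : R) : k%:R <= s <= k.+1%:R ->
  k%:R <= t <= k.+1%:R -> pm (word_path g w s) (word_path g w t) <= `|s - t|.
Proof.
move=> sk tk; rewrite (word_pathE g w sk) (word_pathE g w tk).
have [->|[a ->]] := word_pointS g w k.
  by rewrite !edge_pointxx path_metric_vertex // (dist_refl (word_metric hS)) mulr0n normr_ge0.
apply: path_metric_le; rewrite -natr1 in sk tk.
have -> : s - t = (s - k%:R) - (t - k%:R) by ring.
by apply: cayley_path_edge; lra.
Qed.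

Lemma word_path_lipschitz g w (s t : R) : geodesic_word w -> 0 <= s <= t ->
  t <= (size w)%:R -> pm (word_path g w s) (word_path g w t) <= t - s.
Proof.
move=> wg /andP[s0 st] tw; have t0 := le_trans s0 st.
have /andP[slo shi] := truncn_itv s0; have /andP[tlo thi] := truncn_itv t0.
set k := Num.truncn s in slo shi; set m := Num.truncn t in tlo thi.
have kE : k%:R + 1 = k.+1%:R :> R by rewrite natr1.
have mE : m%:R + 1 = m.+1%:R :> R by rewrite natr1.
have con (u v : R) : 0 <= u -> 0 <= v -> cayley_connected S (word_path g w u) (word_path g w v).
  by move=> u0 v0; apply: in_cayley_graph_connected => //; exact: word_path_in_graph.
have : (k <= m)%N by exact: le_truncn.
rewrite leq_eqVlt => /orP[/eqP km|km].
  have : t - s = `|s - t| by rewrite ler0_norm; lra.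
  by rewrite -km in tlo thi; move=> ->; apply: (word_path_edge g w (k := k)); lra.
have mw : (m <= size w)%N by rewrite -(ler_nat R); lra.
have kmR : k.+1%:R <= m%:R :> R by rewrite ler_nat.
have k0 : 0 <= k.+1%:R :> R by []; have m0 : 0 <= m%:R :> R by [].
have mid : pm (word_path g w k.+1%:R) (word_path g w m%:R) = m%:R - k.+1%:R.
  rewrite !word_path_nat path_metric_vertex // (word_point_geodesic hS g wg).
    by rewrite natrB.
  by rewrite km mw.
have e1 : pm (word_path g w s) (word_path g w k.+1%:R) <= k.+1%:R - s.
  have -> : k.+1%:R - s = `|s - k.+1%:R| by rewrite ler0_norm; lra.
  by apply: (word_path_edge g w (k := k)); lra.
have e2 : pm (word_path g w m%:R) (word_path g w t) <= t - m%:R.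
  have -> : t - m%:R = `|m%:R - t| by rewrite ler0_norm; lra.
  by apply: (word_path_edge g w (k := m)); lra.
have := path_metric_triangle (con _ _ s0 k0) (con _ _ k0 t0).
have := path_metric_triangle (con _ _ k0 m0) (con _ _ m0 t0).
lra.
Qed.

(** The path does not increase distances and its ends are [size w] apart, so by
    the triangle inequality no distance is decreased either. *)
Lemma word_path_isometry g w (s t : R) : geodesic_word w ->
  0 <= s <= (size w)%:R -> 0 <= t <= (size w)%:R ->
  pm (word_path g w s) (word_path g w t) = `|s - t|.
Proof.
move=> wg; wlog st : s t / s <= t => [IH sw tw|/andP[s0 sw] /andP[t0 tw]].
  have [st|ts] := leP s t; first exact: IH.
  by rewrite path_metric_sym distrC; apply: IH => //; exact: ltW.
have con (u v : R) : 0 <= u -> 0 <= v -> cayley_connected S (word_path g w u) (word_path g w v).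
  by move=> u0 v0; apply: in_cayley_graph_connected => //; exact: word_path_in_graph.
have w0 : 0 <= (size w)%:R :> R by []; have z0 : 0 <= 0 :> R by [].
rewrite distrC ger0_norm; last by lra.
apply/eqP; rewrite eq_le word_path_lipschitz ?s0 //=.
have full : pm (word_path g w 0) (word_path g w (size w)%:R) = (size w)%:R.
  rewrite -[X in word_path g w X](mulr0n 1) !word_path_nat path_metric_vertex //.
  by rewrite (word_point_geodesic hS g wg) ?subn0 ?leqnn.
have := path_metric_triangle (con _ _ z0 s0) (con _ _ s0 w0).
have := path_metric_triangle (con _ _ s0 t0) (con _ _ t0 w0).
have e1 : pm (word_path g w 0) (word_path g w s) <= s - 0.
  by apply: word_path_lipschitz; rewrite ?lexx.
have e2 : pm (word_path g w t) (word_path g w (size w)%:R) <= (size w)%:R - t.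
  by apply: word_path_lipschitz; rewrite ?t0.
rewrite full; lra.
Qed.

Lemma geodesic_word_segment g (w : seq (alphabet S)) : geodesic_word w ->
  exists A : set (cayley_graph R S),
  [/\ geodesic_segment cd (cayley_vertex g) (cayley_vertex (g * eval w)%g) A,
      forall i, (i <= size w)%N -> A (cayley_vertex (word_point g w i))
    & forall p, A p -> exists2 i, (i <= size w)%N &
        cd p (cayley_vertex (word_point g w i)) <= 1].
Proof.
move=> wg.
pose c (t : R) : cayley_graph R S :=
  if pselect (in_cayley_graph S (word_path g w t)) is left H then exist _ _ H
  else cayley_vertex g.
have cE t : 0 <= t -> sval (c t) = word_path g w t.
  by move=> t0; rewrite /c; case: pselect => // -[]; exact: word_path_in_graph.
have cV (i : nat) : c i%:R = cayley_vertex (word_point g w i).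
  by apply: eq_sig_hprop => [?|]; [exact: Prop_irrelevance|rewrite cE // word_path_nat].
exists [set c t | t in [set t | 0 <= t <= (size w)%:R]]; split.
- exists (size w)%:R, c; split=> //.
  + by rewrite -[X in c X](mulr0n 1) cV /word_point take0 eval_nil mulg1.
  + by rewrite cV /word_point take_size.
  move=> s t sw tw; rewrite /cayley_dist !cE; first exact: word_path_isometry.
    by case/andP: tw.
  by case/andP: sw.
- by move=> i iw; exists i%:R; rewrite //= ler_nat ler0n.
move=> _ [t /= /andP[t0 tw] <-]; have /andP[lo hi] := truncn_itv t0.
exists (Num.truncn t); first by rewrite -(ler_nat R); lra.
rewrite -cV /cayley_dist !cE // -natr1 in hi *.
apply: le_trans (word_path_edge g w (k := Num.truncn t) _ _) _; rewrite -?natr1; try lra.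
by rewrite ger0_norm; lra.
Qed.

Lemma cayley_hyperbolic_thin : hyperbolic_space cd -> exists delta, thin_intervals dist delta.
Proof.
have dP := word_metric hS.
move=> [delta delta1 hyp]; exists (Num.truncn (delta + 1)) => x y z u xuy.
have [w [wg wE [i iw iu]]] := between_geodesic_word hS xuy.
have [v vg [vE _]] := dist_word hS y z; have [v' v'g [v'E _]] := dist_word hS z x.
have [A [gA onA _]] := geodesic_word_segment x wg.
have [B [gB _ nearB]] := geodesic_word_segment y vg.
have [C [gC _ nearC]] := geodesic_word_segment z v'g.
rewrite wE in gA; rewrite vE in gB; rewrite v'E in gC.
have [AB _ _] := hyp _ _ _ _ _ _ gA gB gC.
have [q BCq uq] := AB _ (onA i iw); rewrite iu in uq.
have close g : cd q (cayley_vertex g) <= 1 -> (dist u g <= Num.truncn (delta + 1))%N.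
  move=> qg; rewrite truncn_ge_nat; last by lra.
  rewrite -cayley_dist_vertex; apply: le_trans (cayley_dist_triangle _ q _) _.
  by rewrite lerD.
have bet g' (w' : seq (alphabet S)) j : geodesic_word w' -> (j <= size w')%N ->
    between dist g' (word_point g' w' j) (g' * eval w')%g.
  move=> w'g jw; have := geodesic_seq_between (word_point_geodesic hS g' w'g) jw.
  by rewrite /word_point take0 take_size eval_nil mulg1.
case: BCq => [/nearB|/nearC] [j jw qj].
  by exists (word_point y v j); [right; rewrite -vE; exact: bet|exact: close].
exists (word_point z v' j); last exact: close.
left; have := bet z v' j v'g jw; rewrite v'E /between.
by rewrite !(dist_sym dP _ x) (dist_sym dP z) addnC.
Qed.

(** After multiplication by the denominator [q] of [lambda] the two lengths are
    integers, so [q * eps] can be replaced by its integer part. *)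
Lemma quasigeodesic_quasi_word (lambda : rat) (eps : R) (w : seq (alphabet S)) :
  1 <= lambda -> 0 <= eps ->
  quasigeodesic (ratr lambda) eps w <->
  quasi_word `|numq lambda|%N `|denq lambda|%N (Num.truncn (`|denq lambda|%:R * eps)) w.
Proof.
move=> l1 e0; set p := `|numq lambda|%N; set q := `|denq lambda|%N.
have q0 : 0 < q%:R :> R by rewrite ltr0n absz_gt0 denq_neq0.
have lE : ratr lambda = p%:R / q%:R :> R.
  by rewrite /ratr /p /q !pmulrn !gez0_abs ?denq_ge0 // numq_ge0 (le_trans ler01).
have qe0 : 0 <= q%:R * eps by rewrite mulr_ge0 // ltW.
suff H (u : seq (alphabet S)) : (size u)%:R <= ratr lambda * word_dist R S 1%g (eval u) + eps <->
    (q * size u <= p * len (eval u) + Num.truncn (q%:R * eps))%N.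
  by split=> wq u uw; apply/H/wq.
rewrite lE word_dist_len // -leq_subLR truncn_ge_nat //.
have -> : ((size u)%:R <= p%:R / q%:R * (len (eval u))%:R + eps) =
    (q%:R * (size u)%:R <= p%:R * (len (eval u))%:R + q%:R * eps).
  have fE (a b c : R) : b != 0 -> b * (a / b * c + eps) = a * c + b * eps.
    by move=> b0; field.
  by rewrite -[LHS](ler_pM2l q0) fE // gt_eqF.
have [le|lt] := leqP (q * size u) (p * len (eval u)).
  have -> : (q * size u - p * len (eval u) = 0)%N by apply/eqP; rewrite subn_eq0.
  split=> // _; apply: le_trans (_ : p%:R * (len (eval u))%:R <= _); last by rewrite lerDl.
  by rewrite -!natrM ler_nat.
by rewrite natrB 1?ltnW // lerBlDl !natrM.
Qed.

End CayleyHyperbolic.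

(** * The characterization *)

Lemma hyperbolic_groupP (R : realType) (G : groupType) :
  hyperbolic_group R G <->
  exists2 S : {fset G}, generating S & exists delta, four_point (dist S) delta.
Proof.
split=> [[S hS /(cayley_hyperbolic_thin hS)[delta thin]]|[S hS [delta fp]]]; exists S => //.
  by eexists; exact: thin_intervals_four_point (word_metric hS) _ thin.
exact: four_point_cayley_hyperbolic fp.
Qed.

Theorem theorem1p2 (R : realType) (G : groupType) (hG : finitely_generated G) :
  hyperbolic_group R G <-> QREG R G.
Proof.
rewrite hyperbolic_groupP; split=> [[S0 hS0 [delta fp]] lambda eps S l1 e0 hS|qreg].
  have -> : [set w : seq (alphabet S) | quasigeodesic (ratr lambda) eps w] =
      [set w : seq (alphabet S) | quasi_word `|numq lambda|%N `|denq lambda|%N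
                                   (Num.truncn (`|denq lambda|%:R * eps)) w].
    by apply/seteqP; split=> w /= /quasigeodesic_quasi_word; apply.
  apply: (four_point_regular _ hS0 hS fp).
  rewrite absz_gt0 denq_neq0 /= -lez_nat !gez0_abs ?denq_ge0 ?numq_ge0 ?(le_trans ler01) //.
  have := l1; rewrite -{1}(divq_num_den lambda) ler_pdivlMr ?mul1r ?ler_int //.
  by rewrite ltr0z denq_gt0.
have [S hS] := hG; exists S => //.
have reg n : (0 < n)%N -> regular [set w : seq (alphabet S) | quasi_word n 1 0 w].
  move=> n0; have n1 : 1 <= n%:R :> rat by rewrite ler1n.
  have <- : [set w : seq (alphabet S) | quasigeodesic (ratr n%:R) (0 : R) w] =
      [set w : seq (alphabet S) | quasi_word n 1 0 w].
    apply/seteqP; split=> w /=; rewrite quasigeodesic_quasi_word //;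
      by rewrite mulr0 truncn0 pmulrn numq_int denq_int absz_nat.
  exact: qreg.
exact: regular_four_point hS (reg 1%N isT) (reg 3%N isT).
Qed.
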